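(* Let $L$ be a lattice of rank $d$ and let $P_1,\ldots,P_r\subset L\otimes_{\mathbb{Z}}\mathbb{R}$ be rational polytopes such that $P_1,\ldots,P_a$ are full-dimensional, while the remaining $r-a$ polytopes are lower-dimensional. Let $\alpha_1,\ldots,\alpha_r$ be real scalars such that $\sum_{i=1}^r\alpha_i[P_i]=0$, where $[P_i]$ denotes the indicator function of $P_i$ on $L\otimes\mathbb{R}$. Then $$\sum_{i=1}^a\alpha_iK_{P_i}(y_0;\mathbf{z})=0$$ as an identity of rational functions in $\mathbf{y}$.
   Context: Identify $L\cong\mathbb{Z}^d$ and $L^\vee=\mathrm{Hom}_{\mathbb{Z}}(L,\mathbb{Z})\cong\mathbb{Z}^d$ by dual bases; $\mathbf{v}(\mathbf{x})$ denotes the pairing. A polytope is rational if its vertices lie in $L\otimes\mathbb{Q}$. Let $y_0>1$ be a real parameter. For a full-dimensional rational polytope $P$, the dual lattice function is $$K_P(y_0;\mathbf{z})=\sum_{\mathbf{v}\in L^\vee}y_0^{\min_{\mathbf{x}\in P}\mathbf{v}(\mathbf{x}-\mathbf{z})},$$ which converges for $\mathbf{z}$ in the interior of $P$ and equals there a rational function in $\mathbf{y}=(y_1,\ldots,y_d)$, $y_i=y_0^{z_i}$. $K_P(y_0;\mathbf{z})$ denotes this rational function everywhere. *)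

(* Defs.v *)
From HB Require Import structures.
From mathcomp Require Import all_boot all_order all_algebra.
From mathcomp Require Import all_classical all_reals.
From mathcomp Require Import topology normedtype numfun esum exp.
(* The notations of mpoly clash with those of the analysis library. *)
From mathcomp Require mpoly.
Import -(notations) mpoly.

Set Implicit Arguments.
Unset Strict Implicit.
Unset Printing Implicit Defensive.

Import Order.TTheory GRing.Theory Num.Theory.
Import numFieldNormedType.Exports.

Local Open Scope classical_set_scope.
Local Open Scope ring_scope.

(* In dual bases, the lattice L is Z^d, the space L (x) R is 'rV[R]_d and the
   dual lattice Hom(L, Z) is 'rV[int]_d. *)

Section Polytopes.
Variables (R : realType) (d : nat).
Implicit Types (P A : set 'rV[R]_d) (x y z : 'rV[R]_d) (s : seq 'rV[R]_d).

Definition pairing (v : 'rV[int]_d) x : R :=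
  \sum_(j < d) (v ord0 j)%:~R * x ord0 j.

Definition conv_hull s : set 'rV[R]_d :=
  [set x | exists c : 'I_(size s) -> R,
    [/\ forall i, 0 <= c i, \sum_i c i = 1 & x = \sum_i c i *: s`_i] ].

Definition affine_hull A : set 'rV[R]_d :=
  [set x | exists n (p : 'I_n -> 'rV[R]_d) (c : 'I_n -> R),
    [/\ forall i, A (p i), \sum_i c i = 1 & x = \sum_i c i *: p i] ].

(* The empty set is a polytope. *)
Definition polytope P := exists s, P = conv_hull s.

(* The vertices of a polytope are its extreme points. *)
Definition vertex P x :=
  P x /\ forall y z (t : R), P y -> P z -> 0 < t -> t < 1 ->
    x = t *: y + (1 - t) *: z -> y = x /\ z = x.

Definition rational_point x := forall j, exists q : rat, x ord0 j = ratr q.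

Definition rational_polytope P :=
  polytope P /\ forall x, vertex P x -> rational_point x.

Definition full_dimensional P := affine_hull P = setT.

End Polytopes.

Section DualLatticeFunction.
Variables (R : realType) (d : nat) (y0 : R).
Local Notation poly := (mpoly d R).
Local Notation ratfun := {fraction poly}.
Implicit Types (P : set 'rV[R]_d) (z : 'rV[R]_d).

(* For a nonempty polytope P the infimum is attained, hence a minimum. *)
Definition min_pairing P z (v : 'rV[int]_d) : R :=
  inf [set pairing v (x - z) | x in P].

(* The terms are positive, so the sum is unconditional; it converges if and
   only if its value is finite. *)
Definition dual_lattice_sum P z : \bar R :=
  \esum_(v in [set: 'rV[int]_d]) (y0 `^ min_pairing P z v)%:E.

Definition ratfun_const (c : R) : ratfun :=
  FracField.tofrac (mpolyC d c).

(* f is regular at y, with value a; this does not depend on the choice of the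
   fraction p / q among those with q(y) <> 0. *)
Definition ratfun_value (f : ratfun) (y : 'I_d -> R) (a : R) :=
  exists p q : poly,
    [/\ f = FracField.tofrac p / FracField.tofrac q,
        meval y q != 0 & a = meval y p / meval y q].

Definition represents_dual_lattice_sum P (f : ratfun) :=
  forall z, interior P z -> exists a : R,
    dual_lattice_sum P z = a%:E /\
    ratfun_value f (fun i => y0 `^ z ord0 i) a.

(* The rational function K_P(y0; z) in y_i = y0 ^ z_i. If P is
   a full-dimensional rational polytope and y0 > 1, then there is exactly one
   rational function as required; the default value 0 serves only for other
   arguments. *)
Definition dual_lattice_fun P : ratfun :=
  xget 0 (represents_dual_lattice_sum P).

End DualLatticeFunction.

(* Main.v *)
Require Import Defs.
From HB Require Import structures.
From mathcomp Require Import all_boot all_order all_algebra.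
From mathcomp Require Import all_classical all_reals.
From mathcomp Require Import topology normedtype numfun esum exp.
From mathcomp Require Import function_spaces ereal sequences derive.
From mathcomp Require mpoly.
From mathcomp Require Import ring lra.
Import -(notations) mpoly.
Import Order.TTheory GRing.Theory Num.Theory.
Import numFieldNormedType.Exports.
Local Open Scope classical_set_scope.
Local Open Scope ring_scope.

(** Write [m_P v] for the minimum of [v] on [P]. For every nonempty polytope [P],
    full-dimensional or not, consider the formal two-sided Laurent series
    [G_P = sum_v y0^(m_P v) y^(-v)], that is, the function [v |-> y0^(m_P v)] on
    the dual lattice [Z^d]. The theorem results from two facts.

    - For fixed [v], the map [P |-> y0^(m_P v)] is a valuation: a linear relation
      between indicators of compact convex sets gives the same relation between
      the values of any function of their minima ([min_pairing_relation]). Hence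
      [sum_i alpha_i G_{P_i} = 0], coefficient by coefficient, over the nonempty
      [P_i].
    - Say that a series [F] sums to the rational function [p / q] when
      [q F = p] for Laurent polynomials [p] and [q <> 0] ([sums_to]). The sum is
      linear, and the zero series sums only to 0. If [P] is full-dimensional then
      [G_P] sums to [K_P] ([full_series]). If [P] is flat, some nonzero [u] in
      the dual lattice is constant on [P], so that shifting by [u] multiplies
      [G_P] by a constant and [G_P] sums to 0 ([flat_series]).

    Summing the relation between the [G_{P_i}] gives the theorem.

    For [full_series] one must produce a single rational function that is both
    the formal sum of [G_P] and the value of the convergent series at every
    interior point. This replaces the triangulation of the normal fan of [P] by
    an argument on monomials. As the vertices are rational, Dickson's lemma gives
    finitely many nonzero [u_1, ..., u_k] such that every [v] is a combination
    [sum_i n_i u_i] with natural coefficients for which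
    [m_P v = sum_i n_i m_P u_i] ([generators]). The lexicographically minimal
    exponents of this kind form a set [D] that is closed downwards in [N^k] and in
    bijection with [Z^d] ([tame_setT]). A closed-down set is a finite disjoint
    union of translates of coordinate orthants, because a descending chain of such
    sets is stationary ([down_chain_stab]). Therefore [G_P] is a finite sum of
    iterated geometric series with ratios [y0^(m_P u_i) y^(-u_i)] ([tame_down]).
    At an interior point [z] these ratios are smaller than 1, because
    [m_P u < u(z)] for [u <> 0]; so there the series converges and no denominator
    vanishes. Finally, a rational function is determined by its values on the
    image of an open set of [z], whence [K_P] is the function so obtained
    ([represents_unique]). *)

Set Implicit Arguments.
Unset Strict Implicit.
Unset Printing Implicit Defensive.

(** * Exponent vectors and Dickson's lemma *)

Section Dickson.
Local Open Scope nat_scope.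
Implicit Types (a b x : seq nat) (S : set (seq nat)).

(** An exponent vector in [N^k] is a list of length [k], so that inductions on [k]
    proceed by slices with a given head. *)
Definition lev a b := all2 leq a b.

Fixpoint addns a b : seq nat :=
  match a, b with
  | i :: a', j :: b' => (i + j) :: addns a' b'
  | _, _ => [::]
  end.

Fixpoint ltlex a b : bool :=
  match a, b with
  | i :: a', j :: b' => (i < j) || (i == j) && ltlex a' b'
  | _, _ => false
  end.

(** Induction on [n]. The tails of elements of [S] have a finite basis [B'];
    choose a head [h b] for each [b] in it. An element whose head is at least
    [K = max h] lies above some [h b :: b], and each of the finitely many slices
    with head [k < K] has a finite basis by induction. *)
Lemma dickson n S : (forall x, S x -> size x = n) ->
  exists B : seq (seq nat), (forall b, b \in B -> S b) /\
    forall x, S x -> exists2 b, b \in B & lev b x.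
Proof.
elim: n S => [|n IHn] S sS.
  have [S0|nS0] := pselect (S [::]).
    exists [:: [::]]; split => [b|x Sx]; first by rewrite inE => /eqP->.
    by exists [::] => //; rewrite (size0nil (sS _ Sx)).
  exists [::]; split=> // x Sx; case: nS0; by rewrite -(size0nil (sS _ Sx)).
have [|B' [B'S B'P]] := IHn [set x | exists k, S (k :: x)].
  by move=> x [k /sS []].
have /choice[h hP] : forall b, exists k, b \in B' -> S (k :: b).
  by move=> b; have [/B'S[k Sk]|_] := boolP (b \in B'); [exists k|exists 0].
pose K := \max_(b <- B') h b.
have slice k : exists Bk : seq (seq nat), (forall b, b \in Bk -> S (k :: b)) /\
    forall x, S (k :: x) -> exists2 b, b \in Bk & lev b x.
  by apply: IHn => x /sS [].
have [Bs BsP] := choice slice.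
exists ([seq h b :: b | b <- B'] ++
        flatten [seq [seq k :: b | b <- Bs k] | k <- iota 0 K]).
split => [b|x Sx].
  rewrite mem_cat => /orP[/mapP[b' b'B ->]|]; first exact: hP.
  by case/flatten_mapP => k _ /mapP[b' b'B ->]; apply: (BsP k).1.
case: x Sx => [/sS//|k x Sx].
have [kK|Kk] := ltnP k K.
  have [b bB bx] := (BsP k).2 _ Sx; exists (k :: b); last by rewrite /lev/= leqnn.
  rewrite mem_cat; apply/orP; right; apply/flatten_mapP; exists k.
    by rewrite mem_iota.
  exact: map_f.
have [|b bB bx] := B'P x; first by exists k.
exists (h b :: b); first by rewrite mem_cat map_f.
rewrite /lev /= [all2 _ _ _]bx andbT (leq_trans _ Kk)//.
exact: (@leq_bigmax_seq _ B' predT h).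
Qed.

(** Dickson's lemma in [N^(n+1)] applied to the pairs [(k, x)] with [x] outside
    [D k], which form a set closed upwards: beyond all first coordinates of
    a finite basis, no further [x] leaves the chain. *)
Lemma down_chain_stab n (D : nat -> set (seq nat)) :
  (forall k x, D k x -> size x = n) ->
  (forall k x y, D k y -> lev x y -> D k x) ->
  (forall k l x, k <= l -> D l x -> D k x) ->
  exists k0, forall k x, k0 <= k -> D k x <-> D k0 x.
Proof.
move=> sD dD cD.
(* The list [k :: x] codes the pair [(k, x)]. *)
have [|B [BS BP]] := @dickson n.+1 [set x | size x = n.+1 /\
  ~ D (head 0 x) (behead x)].
  by move=> x [].
exists (\max_(b <- B) head 0 b) => k x lek; split=> [|Dx]; first exact: cD.
apply/not_notP => nDx.
have [|b bB bx] := BP (k :: x); first by split=> //=; rewrite (sD _ _ Dx).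
have [sb nb] := BS _ bB.
apply: nb; apply: (@cD _ (\max_(b <- B) head 0 b)).
  exact: (@leq_bigmax_seq _ B predT (head 0)).
apply: dD Dx _; case: b {bB} bx sb => //= i b.
by rewrite /lev /= => /andP[].
Qed.

Lemma size_addns a b : size a = size b -> size (addns a b) = size a.
Proof. by elim: a b => [|i a IH] [|j b]//= [/IH->]. Qed.

Lemma lev_refl a : lev a a.
Proof. by elim: a => //= i a; rewrite /lev /= leqnn. Qed.

Lemma lev_size a b : lev a b -> size a = size b.
Proof. by elim: a b => [|i a IH] [|j b]//= /andP[_ /IH->]. Qed.

Lemma lev_addns a b : lev a b -> exists2 c, size c = size a & b = addns a c.
Proof.
elim: a b => [|i a IH] [|j b]//=; first by exists [::].
move=> /andP[ij /IH[c sc ->]]; exists ((j - i) :: c); rewrite /= ?sc//.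
by rewrite subnKC.
Qed.

(** Compatibility with addition makes the lexicographically minimal exponents a
    set closed downwards, see [tame_setT]. *)
Lemma ltlex_addns a b c : size a = size b -> size c = size b ->
  ltlex a b -> ltlex (addns a c) (addns b c).
Proof.
elim: a b c => [|i a IH] [|j b] [|k c]//= [sa] [sc].
by rewrite ltn_add2r eqn_add2r => /orP[->//|/andP[-> /IH->]//]; rewrite orbT.
Qed.

Lemma ltlex_total a b : size a = size b -> [\/ a = b, ltlex a b | ltlex b a].
Proof.
elim: a b => [|i a IH] [|j b]//=; first by constructor 1.
move=> [/IH[->|H|H]]; have [ij|ij|->] := ltngtP i j;
  by [constructor 1|constructor 2; rewrite ?H ?orbT|constructor 3; rewrite ?H ?orbT].
Qed.

Lemma ltlex_min n S : (forall x, S x -> size x = n) -> S !=set0 ->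
  exists2 a, S a & forall b, S b -> ~~ ltlex b a.
Proof.
elim: n S => [|n IHn] S sS [x Sx].
  by exists x => // b Sb; rewrite (size0nil (sS _ Sx)) (size0nil (sS _ Sb)).
have exk : exists k, `[< exists y, S (k :: y) >].
  by case: x Sx => [/sS//|k x Sx]; exists k; apply/asboolP; exists x.
case: (ex_minnP exk) => k /asboolP[y Sy] mink.
have [||a Sa mina] := IHn [set y | S (k :: y)]; first by move=> z /sS[].
  by exists y.
exists (k :: a) => // -[/sS//|i b] Sb /=.
have ki : k <= i by apply: mink; apply/asboolP; exists b.
rewrite negb_or -leqNgt ki /= negb_and.
by have [ik|//] := eqVneq i k; rewrite mina// /= -ik.
Qed.

End Dickson.

(** * Values of rational functions and sums of two-sided series *)

Lemma divf_cross (F : fieldType) (a b c e : F) : b != 0 -> e != 0 ->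
  a / b = c / e -> a * e = c * b.
Proof. by move=> b0 e0 /eqP; rewrite eqr_div// => /eqP. Qed.

Lemma lin_div (F : fieldType) (c n q n' q' : F) : q != 0 -> q' != 0 ->
  c * (n / q) + n' / q' = (c * (q' * n) + q * n') / (q * q').
Proof. by move=> q0 q'0; field; rewrite q0 q'0. Qed.

Section RationalFunctionValues.
Variables (R : realType) (d : nat).
Local Notation poly := (mpoly d R).
Local Notation ratfun := {fraction poly}.
Local Notation tofrac := (@FracField.tofrac poly).
Implicit Types (f g : ratfun) (y : 'I_d -> R) (a b c : R).

Lemma tofrac_neq0 y (q : poly) : meval y q != 0 -> tofrac q != 0.
Proof.
by apply: contraNneq => /eqP; rewrite tofrac_eq0 => /eqP ->; rewrite meval0.
Qed.

(** Two fractions for the same rational function satisfy [p q' = p' q], and this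
    identity may be evaluated. *)
Lemma ratfun_value_uniq f y a b :
  ratfun_value f y a -> ratfun_value f y b -> a = b.
Proof.
move=> [p [q [fE q0 ->]]] [p' [q' [fE' q'0 ->]]].
have E : tofrac (p * q') = tofrac (p' * q).
  have := divf_cross (tofrac_neq0 q0) (tofrac_neq0 q'0) (etrans (esym fE) fE').
  by move=> E; rewrite (tofracM p q') (tofracM p' q).
have {}E : p * q' = p' * q by apply/eqP; rewrite -tofrac_eq E.
have {}E := congr1 (meval y) E.
rewrite (mevalM y p q') (mevalM y p' q) in E.
by apply/eqP; rewrite eqr_div// E.
Qed.

Lemma ratfun_value_tofrac (p : poly) y : ratfun_value (tofrac p) y (meval y p).
Proof.
exists p, 1; split; first by rewrite tofrac1 divr1.
  by rewrite meval1 oner_eq0.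
by rewrite meval1 divr1.
Qed.

Lemma ratfun_value_const c y : ratfun_value (ratfun_const d c) y c.
Proof. by have := ratfun_value_tofrac (mpolyC d c) y; rewrite mevalC. Qed.

Lemma ratfun_value1 y : ratfun_value 1 y 1.
Proof. by have := ratfun_value_tofrac 1 y; rewrite tofrac1 meval1. Qed.

Lemma ratfun_value0 y : ratfun_value 0 y 0.
Proof. by have := ratfun_value_tofrac 0 y; rewrite tofrac0 meval0. Qed.

Lemma ratfun_valueD f g y a b : ratfun_value f y a -> ratfun_value g y b ->
  ratfun_value (f + g) y (a + b).
Proof.
move=> [p [q [-> q0 ->]]] [p' [q' [-> q'0 ->]]].
exists (p * q' + p' * q), (q * q'); split.
- by rewrite addf_div ?tofrac_neq0 -?tofracM -?tofracD// (@tofrac_neq0 y).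
- by rewrite mevalM mulf_neq0.
- by rewrite addf_div// mevalD !mevalM.
Qed.

Lemma ratfun_valueM f g y a b : ratfun_value f y a -> ratfun_value g y b ->
  ratfun_value (f * g) y (a * b).
Proof.
move=> [p [q [-> q0 ->]]] [p' [q' [-> q'0 ->]]].
exists (p * p'), (q * q'); split.
- by rewrite mulf_div -!tofracM.
- by rewrite mevalM mulf_neq0.
- by rewrite mulf_div !mevalM.
Qed.

Lemma ratfun_valueV f y a : a != 0 -> ratfun_value f y a ->
  ratfun_value f^-1 y a^-1.
Proof.
move=> a0 [p [q [-> q0 aE]]]; exists q, p; split.
- by rewrite invf_div.
- by apply: contra_neq a0 => p0; rewrite aE p0 mul0r.
- by rewrite aE invf_div.
Qed.

Lemma ratfun_value_exp f y a (n : nat) : ratfun_value f y a ->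
  ratfun_value (f ^+ n) y (a ^+ n).
Proof.
move=> fa; elim: n => [|n IHn]; first exact: ratfun_value1.
by rewrite !exprS; apply: ratfun_valueM.
Qed.

Lemma ratfun_value_exprz f y a (z : int) : a != 0 -> ratfun_value f y a ->
  ratfun_value (f ^ z) y (a ^ z).
Proof.
move=> a0 fa; case: z => n; first exact: ratfun_value_exp.
by rewrite !NegzE -!exprnN; apply: ratfun_valueV;
  [rewrite expf_neq0|exact: ratfun_value_exp].
Qed.

Lemma ratfun_value_prod (I : finType) (F : I -> ratfun) (A : I -> R) y :
  (forall i, ratfun_value (F i) y (A i)) ->
  ratfun_value (\prod_i F i) y (\prod_i A i).
Proof.
move=> FA; apply: (big_rec2 (fun f a => ratfun_value f y a)).
  exact: ratfun_value1.
by move=> i a f _; apply: ratfun_valueM.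
Qed.

Definition yvar (j : 'I_d) : ratfun := tofrac (mpolyX R (mnm1 j)).

Lemma yvar_neq0 j : yvar j != 0.
Proof.
by apply: (@tofrac_neq0 (fun=> 1)); rewrite mevalXU oner_eq0.
Qed.

Lemma ratfun_value_yvar j y : ratfun_value (yvar j) y (y j).
Proof.
by have := ratfun_value_tofrac (mpolyX R (mnm1 j)) y; rewrite mevalXU.
Qed.

(** The monomial [y^(-u)]. The sign comes from the term of [v] in the dual lattice
    series, [y0^(m v - v(z)) = y0^(m v) y^(-v)] where [y_j = y0^(z_j)]. *)
Definition chi (u : 'rV[int]_d) : ratfun := \prod_j yvar j ^ (- u ord0 j).

Lemma chiD u v : chi (u + v) = chi u * chi v.
Proof.
rewrite /chi -big_split/=; apply: eq_bigr => j _.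
by rewrite mxE opprD expfzDr// yvar_neq0.
Qed.

Lemma chi0 : chi 0 = 1.
Proof. by rewrite /chi big1// => j _; rewrite mxE oppr0 expr0z. Qed.

Lemma ratfun_constM : {morph ratfun_const d : a b / a * b >-> (a * b : ratfun)}.
Proof. by move=> a b; rewrite /ratfun_const mpolyCM tofracM. Qed.

Lemma ratfun_constD : {morph ratfun_const d : a b / a + b >-> (a + b : ratfun)}.
Proof. by move=> a b; rewrite /ratfun_const mpolyCD tofracD. Qed.

Lemma ratfun_constN a : ratfun_const d (- a) = - ratfun_const d a.
Proof. by rewrite /ratfun_const mpolyCN tofracN. Qed.

Lemma ratfun_const1 : ratfun_const d (1 : R) = 1.
Proof. by rewrite /ratfun_const mpolyC1 tofrac1. Qed.

Lemma ratfun_const0 : ratfun_const d (0 : R) = 0.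
Proof. by rewrite /ratfun_const mpolyC0 tofrac0. Qed.

Variable y0 : R.
Hypothesis y0_gt1 : 1 < y0.
Let y0_gt0 : 0 < y0. Proof. exact: lt_trans y0_gt1. Qed.

Lemma ratfun_value_chi u (z : 'rV[R]_d) :
  ratfun_value (chi u) (fun j => y0 `^ z ord0 j) (y0 `^ (- pairing u z)).
Proof.
have -> : y0 `^ (- pairing u z) = \prod_j (y0 `^ z ord0 j) ^ (- u ord0 j).
  rewrite /pairing -sumrN.
  rewrite (@big_morph _ _ (powR y0) 1 *%R 0 +%R).
  - apply: eq_bigr => j _.
    have <- := powR_intmul (- u ord0 j) (powR_ge0 y0 (z ord0 j)).
    by rewrite -powRrM mulrNz mulrN mulrC.
  - by move=> s t; rewrite powRD ?(gt_eqF y0_gt0) ?implybT.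
  - exact: powRr0.
apply: ratfun_value_prod => j; apply: ratfun_value_exprz.
  by rewrite gt_eqF// powR_gt0.
exact: ratfun_value_yvar.
Qed.

Lemma ratfun_value_geom c u (z : 'rV[R]_d) :
  ratfun_value (1 - ratfun_const d c * chi u) (fun j => y0 `^ z ord0 j)
    (1 - c * y0 `^ (- pairing u z)).
Proof.
rewrite -[- (ratfun_const _ _ * _)]mulNr -[- (c * _)]mulNr -ratfun_constN.
apply: ratfun_valueD; first exact: ratfun_value1.
apply: ratfun_valueM; [exact: ratfun_value_const|exact: ratfun_value_chi].
Qed.

Lemma pairingZ u (t : R) (z : 'rV[R]_d) : pairing u (t *: z) = t * pairing u z.
Proof.
by rewrite /pairing mulr_sumr; apply: eq_bigr => j _; rewrite mxE mulrCA.
Qed.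

Lemma pairing_self_gt0 u : u != 0 -> 0 < pairing u (map_mx intr u : 'rV[R]_d).
Proof.
move=> u0; rewrite lt_neqAle; apply/andP; split; last first.
  by apply: sumr_ge0 => j _; rewrite mxE -expr2 sqr_ge0.
apply: contra_neq u0; rewrite /pairing => /esym/eqP.
rewrite psumr_eq0; last by move=> j _; rewrite mxE -expr2 sqr_ge0.
move/allP => H; apply/rowP => j; rewrite mxE.
have /= := H j (mem_index_enum _); rewrite mxE mulf_eq0 orbb intr_eq0.
by move/eqP.
Qed.

(** Values suffice to see that a rational function is nonzero; here the points
    [t *: u], with [u] seen as a real vector, are enough. *)
Lemma geom_neq0 c u : u != 0 -> 1 - ratfun_const d c * chi u != 0.
Proof.
move=> u0; pose z : 'rV[R]_d := map_mx intr u.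
have uz : 0 < pairing u z by exact: pairing_self_gt0.
(* As [t] varies, the binomial takes at [t *: z] the value
   [1 - c * y0 ^ (- t * pairing u z)], which vanishes for at most one [t]. *)
pose t := (if c == 1 then 1 else 0) / pairing u z.
have ne : 1 - c * y0 `^ (- pairing u (t *: z)) != 0.
  rewrite pairingZ /t (divfK (lt0r_neq0 uz)); case: (eqVneq c 1) => [->|c1].
    rewrite mul1r subr_eq0 eq_sym powRN powRr1 ?ltW// lt_eqF//.
    by rewrite invf_lt1.
  by rewrite oppr0 powRr0 mulr1 subr_eq0 eq_sym.
have H := ratfun_value_geom c u (t *: z).
apply: contraNneq ne => E; apply/eqP.
by apply: ratfun_value_uniq H _; rewrite E; exact: ratfun_value0.
Qed.

End RationalFunctionValues.

Section TwoSidedSeries.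
Variables (R : realType) (d : nat).
Local Notation poly := (mpoly d R).
Local Notation ratfun := {fraction poly}.
Local Notation V := 'rV[int]_d.
Implicit Types (Q N : seq (R * V)) (F G : V -> R) (f g : ratfun) (u v : V).

(** Laurent polynomials are lists of terms [(c, u)], standing for [c y^(-u)], with
    no normal form: [lact] is their action on two-sided series, [lval] their
    value as rational functions. *)
Definition lact Q F v := \sum_(x <- Q) x.1 * F (v - x.2).
Definition lval Q : ratfun := \sum_(x <- Q) ratfun_const d x.1 * chi R x.2.
Definition lmul Q Q' := [seq (x.1 * y.1, x.2 + y.2) | x <- Q, y <- Q'].
Definition delta0 v : R := (v == 0)%:R.

(** [delta0] is the unit series, so [Q F = N] as series. Two-sided series form
    a module with torsion over the Laurent polynomials: nonzero series may sum to
    0, as happens for flat polytopes. *)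
Definition sums_to F f := exists Q N,
  [/\ lval Q != 0, lact Q F =1 lact N delta0 & f = lval N / lval Q].

Lemma lact_mul Q Q' F v : lact (lmul Q Q') F v = lact Q (lact Q' F) v.
Proof.
rewrite /lact /lmul big_allpairs_dep/=; apply: eq_bigr => x _.
rewrite mulr_sumr; apply: eq_bigr => y _.
by rewrite mulrA opprD addrA.
Qed.

Lemma lval_mul Q Q' : lval (lmul Q Q') = lval Q * lval Q'.
Proof.
rewrite /lval /lmul big_allpairs_dep/= mulr_suml; apply: eq_bigr => x _.
rewrite mulr_sumr; apply: eq_bigr => y _.
by rewrite ratfun_constM chiD mulrACA.
Qed.

Lemma lact_eq Q F G : F =1 G -> lact Q F =1 lact Q G.
Proof. by move=> FG v; apply: eq_bigr => x _; rewrite FG. Qed.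

Lemma lactC Q Q' F : lact Q (lact Q' F) =1 lact Q' (lact Q F).
Proof.
move=> v; rewrite /lact.
under eq_bigr do rewrite mulr_sumr; rewrite exchange_big/=.
apply: eq_bigr => y _; rewrite mulr_sumr; apply: eq_bigr => x _.
by rewrite mulrCA addrAC.
Qed.

Lemma lact_lin Q c F G v :
  lact Q (fun w => c * F w + G w) v = c * lact Q F v + lact Q G v.
Proof.
rewrite /lact mulr_sumr -big_split/=; apply: eq_bigr => x _.
by rewrite mulrDr mulrCA.
Qed.

Lemma lact_cat Q Q' F v : lact (Q ++ Q') F v = lact Q F v + lact Q' F v.
Proof. by rewrite /lact big_cat. Qed.

Lemma lval_cat Q Q' : lval (Q ++ Q') = lval Q + lval Q'.
Proof. by rewrite /lval big_cat. Qed.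

Lemma lact1 c u F v : lact [:: (c, u)] F v = c * F (v - u).
Proof. by rewrite /lact big_seq1. Qed.

Lemma lval1 c u : lval [:: (c, u)] = ratfun_const d c * chi R u.
Proof. by rewrite /lval big_seq1. Qed.

Lemma lvalC c : lval [:: (c, 0)] = ratfun_const d c.
Proof. by rewrite lval1 chi0 mulr1. Qed.

Lemma sums_to_eq F G f : F =1 G -> sums_to F f -> sums_to G f.
Proof.
move=> FG [Q [N [Q0 QF ->]]]; exists Q, N; split=> // v.
by rewrite -QF; apply: lact_eq => w; rewrite FG.
Qed.

(** The product of the two denominators serves for both series, because Laurent
    polynomials commute. *)
Lemma sums_to_lin c F G f g : sums_to F f -> sums_to G g ->
  sums_to (fun v => c * F v + G v) (ratfun_const d c * f + g).
Proof.
move=> [Q [N [Q0 QF ->]]] [Q' [N' [Q'0 QG ->]]].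
exists (lmul Q Q'), (lmul [:: (c, 0)] (lmul Q' N) ++ lmul Q N'); split.
- rewrite lval_mul; exact: mulf_neq0 Q0 Q'0.
- move=> v; rewrite lact_lin lact_cat !lact_mul lactC lact1 subr0 lact_mul.
  by rewrite (lact_eq _ QF) (lact_eq _ QG).
- rewrite lval_cat (lval_mul Q Q') (lval_mul Q N') (lval_mul _ (lmul Q' N)).
  rewrite (lval_mul Q' N) lvalC; exact: lin_div Q0 Q'0.
Qed.

Lemma sums_to_shift c u F f : sums_to F f ->
  sums_to (fun v => c * F (v - u)) (ratfun_const d c * chi R u * f).
Proof.
move=> [Q [N [Q0 QF ->]]]; exists Q, (lmul [:: (c, u)] N); split=> //.
- move=> v; rewrite lact_mul -(lact_eq _ QF) -lactC.
  by apply: lact_eq => w; rewrite lact1.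
- by rewrite lval_mul lval1 mulrA.
Qed.

(** The equation says that [(1 - c y^(-u)) G = F]: the series [G] is the
    geometric series of ratio [c y^(-u)] started at [F], or any other solution. *)
Lemma sums_to_geom c u F G f : sums_to F f ->
  (forall v, G v - c * G (v - u) = F v) -> 1 - ratfun_const d c * chi R u != 0 ->
  sums_to G (f / (1 - ratfun_const d c * chi R u)).
Proof.
move=> [Q [N [Q0 QF ->]]] FG ne0.
pose B := [:: (1 : R, 0 : V)] ++ [:: (- c, u)].
have BE : lval B = 1 - ratfun_const d c * chi R u.
  by rewrite lval_cat !lval1 chi0 ratfun_const1 mul1r ratfun_constN mulNr.
exists (lmul Q B), N; split.
- rewrite lval_mul BE; exact: mulf_neq0 Q0 ne0.
- move=> v; rewrite lact_mul -QF; apply: lact_eq => w.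
  by rewrite lact_cat !lact1 mul1r subr0 mulNr FG.
- by rewrite lval_mul BE invfM mulrA.
Qed.

Lemma sums_to_delta0 : sums_to delta0 1.
Proof.
exists [:: (1, 0)], [:: (1, 0)].
by rewrite lval1 ratfun_const1 chi0 mulr1 divr1 oner_eq0.
Qed.

Lemma sums_to0 : sums_to (fun=> 0) 0.
Proof.
exists [:: (1, 0)], [::]; split.
- by rewrite lval1 ratfun_const1 chi0 mulr1 oner_eq0.
- by move=> v; rewrite lact1 mulr0 /lact big_nil.
- by rewrite /lval big_nil mul0r.
Qed.

(** The coefficients of a Laurent polynomial are those of its action on the unit
    series; grouping the terms with equal exponents recovers its value. *)
Lemma lval_lact N : lact N delta0 =1 (fun=> 0) -> lval N = 0.
Proof.
move=> N0; rewrite /lval.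
pose U := undup [seq x.2 | x <- N].
transitivity (\sum_(x <- N) \sum_(u <- U | x.2 == u)
    ratfun_const d x.1 * chi R u).
  rewrite big_seq [RHS]big_seq; apply: eq_bigr => x xN.
  rewrite big_mkcond (bigD1_seq x.2) ?undup_uniq//=; last first.
    by rewrite mem_undup map_f.
  by rewrite eqxx big1 ?addr0// => u /negbTE; rewrite eq_sym => ->.
under eq_bigr do rewrite big_mkcond/=.
rewrite exchange_big big1// => u _.
transitivity (ratfun_const d (lact N delta0 u) * chi R u); last first.
  by rewrite N0 ratfun_const0 mul0r.
rewrite /lact (big_morph _ (@ratfun_constD R d) (@ratfun_const0 R d)).
rewrite mulr_suml; apply: eq_bigr => x _; rewrite /delta0 subr_eq0 eq_sym.
by case: eqP => _; rewrite ?mulr1// mulr0 ratfun_const0 mul0r.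
Qed.

(** Uniqueness of sums: it turns a coefficientwise relation between series into
    a relation between rational functions. *)
Lemma sums_to_zero f : sums_to (fun=> 0) f -> f = 0.
Proof.
move=> [Q [N [_ QN ->]]]; rewrite [lval N]lval_lact ?mul0r// => v.
by rewrite -QN /lact big1// => x _; rewrite mulr0.
Qed.

End TwoSidedSeries.

(** * Subsets of the lattice with a rational generating function *)

(** One inequality holds for every positive factor; applied to [c^-1] it gives the
    converse. *)
Lemma esumZl (R : realType) (T : choiceType) (A : set T) (c : R) (a : T -> \bar R) :
  0 < c -> (forall x, 0 <= a x)%E ->
  (\esum_(x in A) (c%:E * a x) = c%:E * \esum_(x in A) a x)%E.
Proof.
move=> c0 a0.
have le (k : R) (b : T -> \bar R) : 0 < k -> (forall x, 0 <= b x)%E ->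
    (\esum_(x in A) (k%:E * b x) <= k%:E * \esum_(x in A) b x)%E.
  move=> k0 b0; apply: ge_ereal_sup => _ [X [finX XA] <-].
  rewrite -ge0_mule_fsumr//; apply: lee_wpmul2l; first by rewrite lee_fin ltW.
  by apply: ereal_sup_ubound; exists X.
apply/eqP; rewrite eq_le le//=.
rewrite -lee_pdivlMl//; apply: le_trans (le c^-1 _ _ _).
- by apply: le_esum => x _; rewrite muleA -EFinM mulVf ?gt_eqF// mul1e.
- by rewrite invr_gt0.
- by move=> x; rewrite mule_ge0// lee_fin ltW.
Qed.

Section TameSets.
Variables (R : realType) (d : nat) (y0 : R) (m : 'rV[int]_d -> R).
Variable Z : set 'rV[R]_d.
Hypothesis y0_gt1 : 1 < y0.
Hypothesis m0 : m 0 = 0.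
Hypothesis mZ : forall z u, Z z -> u != 0 -> m u < pairing u z.
Local Notation poly := (mpoly d R).
Local Notation ratfun := {fraction poly}.
Local Notation V := 'rV[int]_d.
Implicit Types (A B : set V) (f g : ratfun) (u v : V) (z : 'rV[R]_d).

Let y0_gt0 : 0 < y0. Proof. exact: lt_trans y0_gt1. Qed.

(** The part of [sum_v y0^(m v) y^(-v)] supported on [A] has the formal sum [f],
    and at the points [z] of [Z] it converges to the value of [f], where [f] is
    regular. In the application [m] is the support function of a polytope and [Z]
    is its interior. *)
Definition tame A f :=
  sums_to (fun v => \1_A v * y0 `^ m v) f /\
  forall z, Z z -> exists a : R,
    (\esum_(v in A) (y0 `^ (m v - pairing v z))%:E = a%:E)%E /\
    ratfun_value f (fun i => y0 `^ z ord0 i) a.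

Lemma pairingD u v z : pairing (u + v) z = pairing u z + pairing v z.
Proof.
rewrite /pairing -big_split/=; apply: eq_bigr => j _.
by rewrite mxE intrD mulrDl.
Qed.

Lemma pairingMn u n z : pairing (u *+ n) z = pairing u z *+ n.
Proof.
elim: n => [|n IH]; last by rewrite !mulrS pairingD IH.
by rewrite /pairing big1// => j _; rewrite mxE mul0r.
Qed.

Lemma y0_powD s t : y0 `^ (s + t) = y0 `^ s * y0 `^ t.
Proof. by rewrite powRD ?(gt_eqF y0_gt0) ?implybT. Qed.

Lemma tame_set0 : tame set0 0.
Proof.
split; first by apply: sums_to_eq (sums_to0 R d) => v; rewrite indic0 mul0r.
by move=> z _; exists 0; rewrite esum_set0; split => //; apply: ratfun_value0.
Qed.

Lemma tame_set1 : tame [set 0] 1.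
Proof.
split.
  apply: sums_to_eq (sums_to_delta0 R d) => v; rewrite indicE /delta0.
  have [->|v0] := eqVneq v 0.
    by rewrite m0 powRr0 mulr1 mem_set.
  by rewrite memNset ?mul0r//= => /eqP; apply/negP.
move=> z _; exists 1; split; last exact: ratfun_value1.
rewrite esum_set1 ?lee_fin ?powR_ge0//.
by rewrite m0 /pairing big1 ?subr0 ?powRr0// => j _; rewrite mxE mul0r.
Qed.

Lemma tameU A B f g : A `&` B = set0 -> tame A f -> tame B g ->
  tame (A `|` B) (f + g).
Proof.
move=> AB0 [Af Az] [Bg Bz]; split.
  rewrite -[f]mul1r -(ratfun_const1 R d).
  apply: sums_to_eq (sums_to_lin 1 Af Bg) => v.
  rewrite mul1r -mulrDl; congr (_ * _); rewrite !indicE in_setU.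
  have : ~ (v \in A /\ v \in B).
    by rewrite !inE => ABv; have : (A `&` B) v by []; rewrite AB0.
  case: (v \in A); case: (v \in B) => H; rewrite ?addr0 ?add0r//.
  by case: H.
move=> z /[dup] /Az[a [aE fa]] /Bz[b [bE gb]].
exists (a + b); split; last exact: ratfun_valueD.
rewrite (esumID A); last by move=> v _; rewrite lee_fin powR_ge0.
have -> : (A `|` B) `&` A = A by apply/seteqP; split=> v /=; tauto.
have -> : (A `|` B) `&` ~` A = B.
  apply/seteqP; split=> v /=; first by tauto.
  move=> Bv; split; first by right.
  by move=> Av; have : (A `&` B) v by []; rewrite AB0.
by rewrite aE bE EFinD.
Qed.

(** Translating [A] by [u] multiplies the series by [y0^c y^(-u)] as soon as [m]
    grows by the constant [c]. *)
Lemma tame_shift A f u c : (forall a, A a -> m (a + u) = m a + c) ->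
  tame A f ->
  tame [set a + u | a in A] (ratfun_const d (y0 `^ c) * chi R u * f).
Proof.
move=> mA [Af Az]; split.
  apply: sums_to_eq (sums_to_shift (y0 `^ c) u Af) => v /=.
  have [vA|vA] := pselect ([set a + u | a in A] v).
    rewrite !indicE (mem_set vA) mem_set; last by case: vA => a Aa <-; rewrite addrK.
    by case: vA => a Aa <-; rewrite addrK mA// !mul1r addrC y0_powD.
  rewrite !indicE !memNset ?mul0r ?mulr0// => vuA; apply: vA.
  by exists (v - u) => //; rewrite subrK.
move=> z /Az[a [aE fa]].
exists (y0 `^ c * y0 `^ (- pairing u z) * a); split; last first.
  apply: ratfun_valueM fa; apply: ratfun_valueM.
    exact: ratfun_value_const.
  exact: ratfun_value_chi.
rewrite esum_image; last by move=> x y _ _; apply: addIr.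
rewrite EFinM -aE -esumZl; first apply: eq_esum => v Av.
- by rewrite -EFinM -!y0_powD (mA _ Av) pairingD; congr (_ `^ _)%:E; ring.
- by rewrite mulr_gt0// powR_gt0.
- by move=> v; rewrite lee_fin powR_ge0.
Qed.

Lemma nneseries_geometric (t s : R) : 0 <= t < 1 -> 0 <= s ->
  (\sum_(0 <= k <oo) (s * t ^+ k)%:E = (s / (1 - t))%:E)%E.
Proof.
move=> /andP[t0 t1] s0; apply/cvg_lim => //.
under eq_fun do rewrite sumEFin.
apply: cvg_EFin; first by near=> n.
by apply: cvg_geometric_series; rewrite ger0_norm.
Unshelve. all: by end_near. Qed.

(** On the disjoint union of the translates [B + k u] the series is the geometric
    series of ratio [y0^(m u) y^(-u)] started at the series of [B]. At [z] in [Z]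
    this ratio takes the value [y0^(m u - u(z)) < 1], so the series converges and
    the new denominator does not vanish. *)
Lemma tame_geom B f u : u != 0 ->
  (forall b k, B b -> m (b + u *+ k) = m b + m u *+ k) ->
  (forall b b' k k', B b -> B b' -> b + u *+ k = b' + u *+ k' -> k = k') ->
  tame B f ->
  tame (\bigcup_k [set b + u *+ k | b in B])
    (f / (1 - ratfun_const d (y0 `^ m u) * chi R u)).
Proof.
move=> u0 mB injB [Bf Bz]; split.
  apply: sums_to_geom Bf _ _; last exact: (geom_neq0 y0_gt1).
  move=> v; set S := \bigcup_k _.
  have [Bv|nBv] := pselect (B v).
    have Sv : S v by exists 0%N => //; exists v => //; rewrite mulr0n addr0.
    have nS : ~ S (v - u).
      move=> [k _ [b Bb bE]].
      have := injB b v k.+1 0%N Bb Bv; rewrite mulrS addrCA bE addrC subrK.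
      by rewrite mulr0n addr0 => /(_ erefl).
    by rewrite !indicE (mem_set Bv) (mem_set Sv) (memNset nS) mul0r mulr0 subr0.
  have [Sv|nSv] := pselect (S v).
    have [b [k [Bb vE]]] : exists b k, B b /\ v = b + u *+ k.+1.
      case: Sv => -[|k] _ [b Bb vE]; last by exists b, k.
      by move: vE nBv; rewrite mulr0n addr0 => <-.
    have vuE : v - u = b + u *+ k by rewrite vE mulrSr addrA addrK.
    have Svu : S (v - u) by exists k => //; exists b.
    rewrite !indicE (mem_set Sv) (mem_set Svu) (memNset nBv) mul0r !mul1r vuE.
    by rewrite -y0_powD vE !mB// mulrS addrCA subrr.
  rewrite !indicE !memNset// ?mul0r ?mulr0 ?subrr// => -[k _ [b Bb bE]].
  by apply: nSv; exists k.+1 => //; exists b => //; rewrite mulrSr addrA bE subrK.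
move=> z Zz; have [a [aE fa]] := Bz _ Zz.
pose t := y0 `^ (m u - pairing u z).
have t0 : 0 < t by rewrite powR_gt0.
have t1 : t < 1.
  by rewrite /t /powR (gt_eqF y0_gt0) expR_lt1 pmulr_llt0 ?ln_gt0// subr_lt0 mZ.
have tE : 1 - y0 `^ m u * y0 `^ (- pairing u z) = 1 - t by rewrite -y0_powD.
exists (a / (1 - t)); split; last first.
  apply: ratfun_valueM fa _; apply: ratfun_valueV; first by rewrite subr_eq0 gt_eqF.
  by rewrite -tE; apply: ratfun_value_geom.
have a0 : 0 <= a.
  by rewrite -lee_fin -aE; apply: esum_ge0 => v _; rewrite lee_fin powR_ge0.
rewrite esum_bigcupT; last 2 first.
- move=> k k' _ _ [v [[b Bb <-] [b' Bb' E]]].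
  exact: injB Bb Bb' (esym E).
- by move=> v; rewrite lee_fin powR_ge0.
rewrite -nneseries_geometric ?t1 ?(ltW t0)// nneseries_esumT; last first.
  by move=> k; rewrite lee_fin mulr_ge0// exprn_ge0// ltW.
apply: eq_esum => k _.
rewrite esum_image; last by move=> x y _ _; apply: addIr.
rewrite mulrC EFinM -aE -esumZl; first apply: eq_esum => v Bv.
- rewrite -EFinM; have -> : t ^+ k = y0 `^ ((m u - pairing u z) * k%:R).
    by rewrite powRrM powR_mulrn// powR_ge0.
  rewrite -y0_powD (mB _ _ Bv) pairingD pairingMn.
  move: (m v) (m u) (pairing v z) (pairing u z) => mv mu pv pu.
  by congr (_ `^ _)%:E; rewrite -(mulr_natr mu) -(mulr_natr pu); ring.
- by rewrite exprn_gt0.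
- by move=> v; rewrite lee_fin powR_ge0.
Qed.

Fixpoint lincomb (us : seq V) (ns : seq nat) : V :=
  match us, ns with
  | u :: us', n :: ns' => lincomb us' ns' + u *+ n
  | _, _ => 0
  end.

Fixpoint wsum (us : seq V) (ns : seq nat) : R :=
  match us, ns with
  | u :: us', n :: ns' => wsum us' ns' + m u *+ n
  | _, _ => 0
  end.

(** Induction on the number of generators. The slices [D_k] of [D] with first
    exponent [k] are closed downwards and decrease with [k], so they are constant
    from some [k0] on. Hence the image of [D] is the disjoint union of finitely
    many translates [A_k + k u] with [k < k0], and of the translate by [k0 u] of
    the union of all [A_k0 + k u], to which [tame_geom] applies. The slices
    themselves are handled by induction. *)
Lemma tame_down us (D : set (seq nat)) : all (fun u => u != 0) us ->
  (forall x, D x -> size x = size us) ->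
  (forall x y, D y -> lev x y -> D x) ->
  (forall x, D x -> m (lincomb us x) = wsum us x) ->
  (forall x y, D x -> D y -> lincomb us x = lincomb us y -> x = y) ->
  exists f, tame (lincomb us @` D) f.
Proof.
elim: us D => [|u us IH] D.
  move=> _ sD _ _ _; have [D0|nD0] := pselect (D [::]).
    exists 1; rewrite (_ : _ @` _ = [set 0]); first exact: tame_set1.
    apply/seteqP; split => [v [x Dx <-]//|v -> /=].
    by exists [::].
  exists 0; rewrite (_ : _ @` _ = set0); first exact: tame_set0.
  by rewrite -subset0 => v [x /[dup] /sD/size0nil -> /nD0].
move=> /= /andP[u0 us0] sD dD mD injD.
pose Dk k := [set x | D (k :: x)].
pose A k := lincomb us @` Dk k.
have sDk k x : Dk k x -> size x = size us by move=> /sD[].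
have dDk k x y : Dk k y -> lev x y -> Dk k x.
  by move=> Dy xy; apply: dD Dy _; rewrite /lev /= leqnn.
have cDk k l x : (k <= l)%N -> Dk l x -> Dk k x.
  move=> kl Dx; apply: dD Dx _; rewrite /lev /= kl; exact: lev_refl.
have mDk k x : Dk k x -> m (lincomb us x) = wsum us x.
  by move=> /(cDk 0%N _ _ (leq0n k)) /mD /=; rewrite !mulr0n !addr0.
have tameA k : exists f, tame (A k) f.
  apply: IH => //; [exact: sDk|exact: dDk|exact: mDk|].
  by move=> x y Dx Dy E; have := injD _ _ Dx Dy; rewrite /= E => /(_ erefl)[].
have mA k a : A k a -> m (a + u *+ k) = m a + m u *+ k.
  by case=> x Dx <-; rewrite (mDk _ _ Dx); exact: (mD (k :: x)).
have injA k l a b : A k a -> A l b -> a + u *+ k = b + u *+ l -> k = l.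
  move=> [x Dx <-] [y Dy <-] E.
  by have := injD _ _ Dx Dy; rewrite /= E => /(_ erefl)[].
have [k0 stab] := down_chain_stab sDk dDk cDk.
have Ak0 k : A k0 `<=` A k.
  move=> _ [x Dx <-]; exists x => //; have [kk0|/ltnW kk0] := leqP k k0.
    exact: cDk Dx.
  by apply/stab.
pose E n := [set v | exists k a, [/\ (k < n)%N, A k a & v = a + u *+ k]].
have [f Ef] : exists f, tame (E k0) f.
  elim: k0 {stab Ak0} => [|n [f Ef]].
    exists 0; rewrite (_ : E _ = set0); first exact: tame_set0.
    by rewrite -subset0 => v [k [a []]].
  have [g Ag] := tameA n.
  exists (f + ratfun_const d (y0 `^ (m u *+ n)) * chi R (u *+ n) * g).
  rewrite (_ : E n.+1 = E n `|` [set a + u *+ n | a in A n]).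
    apply: tameU => //; last by apply: tame_shift => // a; exact: mA.
    rewrite -subset0 => v [[k [a [kn Aa ->]]] [b Ab ba]].
    by move: kn; rewrite (injA _ _ _ _ Ab Aa ba) ltnn.
  apply/seteqP; split => [v [k [a [kn Aa ->]]]|v [[k [a [kn Aa ->]]]|[a Aa <-]]].
  - have [kn'|nk] := ltnP k n; first by left; exists k, a.
    have -> : k = n by apply/eqP; rewrite eqn_leq nk -ltnS kn.
    right; exists a => //.
    by have <- : k = n by apply/eqP; rewrite eqn_leq nk -ltnS kn.
  - by exists k, a; split => //; exact: ltnW.
  - by exists n, a.
have [g Ag] := tameA k0.
have mAk0 b k : A k0 b -> m (b + u *+ k) = m b + m u *+ k.
  by move=> /(Ak0 k); exact: mA.
have injAk0 b b' k k' : A k0 b -> A k0 b' -> b + u *+ k = b' + u *+ k' -> k = k'.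
  by move=> /(Ak0 k) Ab /(Ak0 k'); exact: injA.
have := tame_geom u0 mAk0 injAk0 Ag.
set S := \bigcup_k _; set h := _ / _ => Sh.
exists (f + ratfun_const d (y0 `^ (m u *+ k0)) * chi R (u *+ k0) * h).
rewrite (_ : _ @` _ = E k0 `|` [set a + u *+ k0 | a in S]).
  apply: tameU => //.
    rewrite -subset0 => v [[k [a [kn Aa ->]]] [_ [l _ [b Ab <-]]]].
    rewrite -addrA -mulrnDr => ba.
    have kE := injA _ _ _ _ (Ak0 (l + k0)%N _ Ab) Aa ba.
    by move: kn; rewrite -kE ltnNge leq_addl.
  apply: tame_shift Sh => _ [k _ [b Ab <-]].
  rewrite -addrA -mulrnDr !mA; [|exact: Ak0..].
  by rewrite mulrnDr addrA.
apply/seteqP; split => [_ [[|k x] Dx <-]|v [[k [a [kn [x Dx <-] ->]]]|]].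
- by have := sD _ Dx.
- have [kn|nk] := ltnP k k0.
    by left; exists k, (lincomb us x); split=> //; exists x.
  right; exists (lincomb us x + u *+ (k - k0)).
    exists (k - k0)%N => //; exists (lincomb us x) => //.
    by exists x => //; apply/(stab k).
  by rewrite -addrA -mulrnDr subnK.
- by exists (k :: x).
- move=> [_ [k _ [b Ab <-]] <-].
  have [x Dx <-] := Ak0 (k + k0)%N _ Ab.
  by exists ((k + k0)%N :: x) => //=; rewrite -addrA -mulrnDr.
Qed.

Lemma lincomb_addns us x y : size x = size us -> size y = size us ->
  lincomb us (addns x y) = lincomb us x + lincomb us y.
Proof.
elim: us x y => [|u us IH] [|k x] [|l y]//=; first by rewrite addr0.
by move=> [sx] [sy]; rewrite IH// mulrnDr addrACA.
Qed.

Lemma wsum_addns us x y : size x = size us -> size y = size us ->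
  wsum us (addns x y) = wsum us x + wsum us y.
Proof.
elim: us x y => [|u us IH] [|k x] [|l y]//=; first by rewrite addr0.
by move=> [sx] [sy]; rewrite IH// mulrnDr addrACA.
Qed.

(** Call exponents good if [m] is additive along them. A part of good exponents is
    good, because [m] is superadditive, and replacing a part by other good
    exponents of the same vector keeps the whole good. So the good exponents that
    are lexicographically minimal for their vector form a set closed downwards; it
    is mapped bijectively onto the lattice, and [tame_down] applies to it. *)
Lemma tame_setT us : (forall u v, m u + m v <= m (u + v)) ->
  all (fun u => u != 0) us ->
  (forall v, exists x,
    [/\ size x = size us, lincomb us x = v & m v = wsum us x]) ->
  exists f, tame setT f.
Proof.
move=> msup us0 gen.
pose good x := size x = size us /\ m (lincomb us x) = wsum us x.
pose D := [set x | good x /\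
  forall x', good x' -> lincomb us x' = lincomb us x -> ~~ ltlex x' x].
have wsum_le x : wsum us x <= m (lincomb us x).
  elim: us {us0 gen good D} x => [|u us IH] [|k x]/=; rewrite ?m0//.
  apply: le_trans (msup _ _); apply: lerD (IH _) _.
  elim: k => [|k IHk]; first by rewrite !mulr0n m0.
  by rewrite !mulrS; apply: le_trans (msup _ _); rewrite lerD2l.
have sD x : D x -> size x = size us by case=> [[]].
have mD x : D x -> m (lincomb us x) = wsum us x by case=> [[]].
have injD x y : D x -> D y -> lincomb us x = lincomb us y -> x = y.
  move=> [gx mx] [gy my] E.
  have sxy : size x = size y by rewrite gx.1 gy.1.
  have [//|xy|yx] := ltlex_total sxy.
    by have := my _ gx E; rewrite xy.
  by have := mx _ gy (esym E); rewrite yx.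
have [|f tf] := @tame_down us D us0 sD _ mD injD; last first.
- exists f; rewrite (_ : setT = lincomb us @` D)//.
  apply/seteqP; split => // v _.
  pose S := [set x | good x /\ lincomb us x = v].
  have [||x [gx xv] minx] := @ltlex_min (size us) S; first by move=> x [[]].
    by have [x [sx xv vx]] := gen v; exists x; split => //; split=> //; rewrite xv.
  exists x => //; split => // x' gx' E; apply: minx; split => //.
  by rewrite E.
- move=> x y [[sy my] miny] xy; have [c sc yE] := lev_addns xy.
  have sx : size x = size us by rewrite (lev_size xy).
  have {}sc : size c = size us by rewrite sc.
  (* Both parts of [y = x + c] satisfy [wsum <= m]; equality for the whole
     forces equality for [x]. *)
  have mx : m (lincomb us x) = wsum us x.
    apply/eqP; rewrite eq_le wsum_le andbT -(lerD2r (wsum us c)) -wsum_addns//.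
    rewrite -yE -my yE lincomb_addns//; apply: le_trans (msup _ _).
    by rewrite lerD2l wsum_le.
  split=> // x' [sx' mx'] E; apply/negP => lx.
  have := miny (addns x' c); rewrite yE ltlex_addns ?sx ?sx'// => H.
  suff: false by []; apply: H; last by rewrite !lincomb_addns// E.
  split; first by rewrite size_addns// sx'.
  rewrite lincomb_addns// E -lincomb_addns// -yE my yE !wsum_addns//.
  by rewrite -mx' E mx.
Qed.

End TameSets.

(** * Convex hulls of finitely many points *)

Section Pairing.
Variables (R : realType) (d : nat).
Implicit Types (u v : 'rV[int]_d) (x y z : 'rV[R]_d).

Lemma pairingDr v x y : pairing v (x + y) = pairing v x + pairing v y.
Proof.
by rewrite /pairing -big_split; apply: eq_bigr => j _; rewrite mxE mulrDr.
Qed.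

Lemma pairing0r v : pairing v (0 : 'rV[R]_d) = 0.
Proof. by rewrite /pairing big1// => j _; rewrite mxE mulr0. Qed.

Lemma pairingBr v x y : pairing v (x - y) = pairing v x - pairing v y.
Proof. by rewrite pairingDr -scaleN1r pairingZ mulN1r. Qed.

Lemma pairing_sum v n (c : 'I_n -> R) (p : 'I_n -> 'rV[R]_d) :
  pairing v (\sum_i c i *: p i) = \sum_i c i * pairing v (p i).
Proof.
rewrite (big_morph _ (pairingDr v) (pairing0r v)).
by apply: eq_bigr => i _; rewrite pairingZ.
Qed.

Lemma pairing_delta v j : pairing v (delta_mx ord0 j : 'rV[R]_d) = (v ord0 j)%:~R.
Proof.
rewrite /pairing (bigD1 j)//= mxE !eqxx mulr1 big1 ?addr0// => k kj.
by rewrite mxE eqxx (negbTE kj) mulr0.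
Qed.

Lemma interior_box (P : set 'rV[R]_d) z : interior P z <->
  exists2 e, 0 < e & forall y, (forall j, `|z ord0 j - y ord0 j| < e) -> P y.
Proof.
split.
  move=> /nbhs_ballP[e /= e0 eP]; exists e => // y yz; apply: eP; split=> // i j.
  by rewrite (ord1 i); exact: yz.
move=> [e e0 eP]; apply/nbhs_ballP; exists e => //= y [_ yz]; apply: eP => j.
exact: yz.
Qed.

End Pairing.

Section Hull.
Variables (R : realType) (d : nat).
Local Notation V := 'rV[R]_d.

(** [conv_hull s] is convertible to the hull of the family of entries of [s]; for
    a family, dropping a point is composition with [lift]. *)
Definition hull n (p : 'I_n -> V) : set V :=
  [set x | exists c : 'I_n -> R,
    [/\ forall i, 0 <= c i, \sum_i c i = 1 & x = \sum_i c i *: p i] ].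

Lemma hull_mem n (p : 'I_n -> V) i : hull p (p i).
Proof.
exists (fun j => (j == i)%:R); split => [j||]; first exact: ler0n.
  by rewrite (bigD1 i)//= eqxx big1 ?addr0// => j /negbTE ->.
rewrite (bigD1 i)//= eqxx scale1r big1 ?addr0// => j /negbTE ->.
by rewrite scale0r.
Qed.

Lemma hull_one n (p : 'I_n -> V) (c : 'I_n -> R) i :
  (forall j, 0 <= c j) -> \sum_j c j = 1 -> 1 <= c i ->
  \sum_j c j *: p j = p i.
Proof.
move=> c0; rewrite (bigD1 i)//= => c1 ci.
have s0 : 0 <= \sum_(j < n | j != i) c j by apply: sumr_ge0.
have s0' : \sum_(j < n | j != i) c j = 0 by lra.
have ci1 : c i = 1 by lra.
rewrite (bigD1 i)//= ci1 scale1r big1 ?addr0// => j ji.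
move/eqP: s0'; rewrite psumr_eq0// => /allP/(_ j (mem_index_enum _)).
by rewrite ji => /eqP ->; rewrite scale0r.
Qed.

(** If [p i] lies strictly between two other points of the hull, write both as
    convex combinations of the [p j]. The weight of [p i] in the resulting
    combination is smaller than 1, otherwise both points would equal [p i]; so
    [p i] can be expressed by the other [p j]. *)
Lemma hull_drop n (p : 'I_n.+1 -> V) i : ~ vertex (hull p) (p i) ->
  hull (p \o lift i) = hull p.
Proof.
move=> nv.
have [y [z [t [[c [c0 c1 yE]] [e [e0 e1 zE]] t0 t1 [piE ne]]]]] :
    exists y z (t : R), [/\ hull p y, hull p z, 0 < t, t < 1 &
    p i = t *: y + (1 - t) *: z /\ ~ (y = p i /\ z = p i)].
  apply: contrapT => H; apply: nv; split=> [|y z t yP zP t0 t1 E].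
    exact: hull_mem.
  by apply: contrapT => ne; apply: H; exists y, z, t; split.
have c_le j : c j <= 1.
  by rewrite -c1 (bigD1 j)//= lerDl sumr_ge0.
have e_le j : e j <= 1.
  by rewrite -e1 (bigD1 j)//= lerDl sumr_ge0.
pose a j := t * c j + (1 - t) * e j.
have a0 j : 0 <= a j by rewrite addr_ge0// mulr_ge0// ?subr_ge0 ltW.
have a1 : \sum_j a j = 1.
  by rewrite big_split/= -!mulr_sumr c1 e1; ring.
have aE : p i = \sum_j a j *: p j.
  rewrite piE yE zE !scaler_sumr -big_split/=; apply: eq_bigr => j _.
  by rewrite !scalerA -scalerDl.
have ai : a i < 1.
  rewrite ltNge; apply/negP => ai; apply: ne.
  have := c_le i; have := e_le i; rewrite /a in ai => ei ci.
  split; first by rewrite yE; apply: hull_one => //; nra.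
  by rewrite zE; apply: hull_one => //; nra.
have a1' : 0 < 1 - a i by lra.
have sumD (c' : 'I_n.+1 -> R) : \sum_j c' j = c' i + \sum_j c' (lift i j).
  by rewrite (bigD1_ord i).
pose f j := a (lift i j) / (1 - a i).
have f0 j : 0 <= f j by rewrite divr_ge0// ltW.
have f1 : \sum_j f j = 1.
  rewrite -mulr_suml; have := sumD a; rewrite a1 => E.
  by rewrite (_ : \sum_j _ = 1 - a i) ?divff ?gt_eqF// E; ring.
have fE : p i = \sum_j f j *: p (lift i j).
  have E : (1 - a i) *: p i = \sum_j a (lift i j) *: p (lift i j).
    rewrite scalerBl scale1r {1}aE (bigD1_ord i)//=.
    by rewrite addrAC subrr add0r.
  rewrite -[LHS]scale1r -(mulVf (lt0r_neq0 a1')) -scalerA E scaler_sumr.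
  by apply: eq_bigr => j _; rewrite scalerA mulrC.
apply/seteqP; split => x [b [b0 b1 ->]].
  exists (fun k => if unlift i k is Some j then b j else 0); split.
  - by move=> k; case: unlift.
  - rewrite (bigD1_ord i)//= unlift_none add0r -b1.
    by apply: eq_bigr => j _; rewrite liftK.
  - rewrite (bigD1_ord i)//= unlift_none scale0r add0r.
    by apply: eq_bigr => j _; rewrite liftK.
exists (fun j => b i * f j + b (lift i j)); split.
- by move=> j; rewrite addr_ge0// mulr_ge0.
- by rewrite big_split/= -mulr_sumr f1 mulr1 -sumD.
- rewrite (bigD1_ord i)//= fE scaler_sumr -big_split/=.
  by apply: eq_bigr => j _; rewrite scalerA -scalerDl.
Qed.

(** Minkowski's theorem for polytopes, by dropping points that are not extreme. It
    gives access to the rationality of the vertices when the polytope is presented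
    by arbitrary points. *)
Lemma hull_vertices n (p : 'I_n -> V) : exists k (q : 'I_k -> V),
  hull q = hull p /\ forall i, vertex (hull p) (q i).
Proof.
elim: n p => [|n IHn] p; first by exists 0%N, p; split => // -[].
have [H|/existsNP[i ni]] := pselect (forall i, vertex (hull p) (p i)).
  by exists n.+1, p.
have [k [q [qE qv]]] := IHn (p \o lift i); exists k, q.
by move: qE qv; rewrite hull_drop.
Qed.

Lemma rational_points_scale n (p : 'I_n -> V) :
  (forall i, rational_point (p i)) ->
  exists (N : int) (X : 'I_n -> 'rV[int]_d), 0 < N /\
    forall i, map_mx intr (X i) = N%:~R *: p i.
Proof.
move=> rp.
have /choice[q qP] : forall ij : 'I_n * 'I_d,
    exists q : rat, p ij.1 ord0 ij.2 = ratr q by move=> [i j]; exact: rp.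
exists (\prod_k denq (q k)).
exists (fun i => \row_j (numq (q (i, j)) * \prod_(k | k != (i, j)) denq (q k))).
split; first by apply: prodr_gt0 => k _; exact: denq_gt0.
move=> i; apply/rowP => j; rewrite !mxE (qP (i, j)) /ratr.
rewrite [in RHS](bigD1 (i, j))//= !intrM.
have : (denq (q (i, j)))%:~R != 0 :> R by rewrite intr_eq0 denq_neq0.
move: (\prod_(_ | _) _) => D; move: (denq _) (numq _) => a b a0.
by field.
Qed.

Lemma rational_polytope_points (P : set V) : rational_polytope P -> P !=set0 ->
  exists n (p : 'I_n.+1 -> V) (N : int) (X : 'I_n.+1 -> 'rV[int]_d),
  [/\ P = hull p, 0 < N & forall i, map_mx intr (X i) = N%:~R *: p i].
Proof.
move=> [[s Ps] rP] [x Px].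
have [k [q [qE qv]]] := hull_vertices (fun i : 'I_(size s) => s`_i).
have PE : P = hull q by rewrite qE Ps.
have rq i : rational_point (q i) by apply: rP; rewrite Ps; exact: qv.
have [N [X [N0 XE]]] := rational_points_scale rq.
case: k q PE X XE {qE qv rq} => [|n] q PE X XE; last by exists n, q, N, X.
by exfalso; move: Px; rewrite PE => -[c [_ /esym/eqP]]; rewrite big_ord0 oner_eq0.
Qed.

End Hull.

(** * The support function of a rational polytope *)

Lemma inf_min (R : realType) (A : set R) a :
  A a -> (forall b, A b -> a <= b) -> inf A = a.
Proof.
move=> Aa lbA; apply/eqP; rewrite eq_le lb_le_inf ?andbT//; last by exists a.
by apply: ge_inf => //; exists a.
Qed.

Lemma min_pairingE (R : realType) d (P : set 'rV[R]_d) x0 z v : P x0 ->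
  (forall x, P x -> pairing v x0 <= pairing v x) ->
  min_pairing P z v = pairing v x0 - pairing v z.
Proof.
move=> Px0 minx0; apply: inf_min; first by exists x0 => //; rewrite pairingBr.
by move=> _ [x Px <-]; rewrite pairingBr lerD2r minx0.
Qed.

Section MinPairing.
Variables (R : realType) (d n : nat) (p : 'I_n.+1 -> 'rV[R]_d).
Local Notation V := 'rV[int]_d.
Local Notation P := (hull p).
Local Notation m := (min_pairing P 0).
Implicit Types (u v : V) (i j : 'I_n.+1) (z : 'rV[R]_d).

Definition minimal v i := forall j, pairing v (p i) <= pairing v (p j).

Lemma ex_minimal v : exists i, minimal v i.
Proof.
have [i _ mini] := @arg_minP _ _ _ ord0 predT (fun i => pairing v (p i)) isT.
by exists i => j; exact: mini.
Qed.

Lemma minimal_hull v i x : minimal v i -> P x -> pairing v (p i) <= pairing v x.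
Proof.
move=> mini [c [c0 c1 ->]]; rewrite pairing_sum -[leLHS]mul1r -c1 mulr_suml.
by apply: ler_sum => j _; apply: ler_wpM2l.
Qed.

Lemma min_pairing_minimal v i z : minimal v i ->
  min_pairing P z v = pairing v (p i) - pairing v z.
Proof.
move=> mini; apply: min_pairingE; first exact: hull_mem.
by move=> x; exact: minimal_hull.
Qed.

Lemma min_pairing_shift v z : min_pairing P z v = m v - pairing v z.
Proof.
have [i mini] := ex_minimal v.
by rewrite !(min_pairing_minimal _ mini) pairing0r subr0.
Qed.

Lemma min0E v i : minimal v i -> m v = pairing v (p i).
Proof. by move=> /min_pairing_minimal ->; rewrite pairing0r subr0. Qed.

Lemma min0_le v i : m v <= pairing v (p i).
Proof. by have [j minj] := ex_minimal v; rewrite (min0E minj); exact: minj. Qed.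

Lemma min0_le_hull v x : P x -> m v <= pairing v x.
Proof.
by have [j minj] := ex_minimal v; rewrite (min0E minj); exact: minimal_hull.
Qed.

Lemma min0_0 : m 0 = 0.
Proof.
have [i mini] := ex_minimal 0; rewrite (min0E mini) /pairing big1// => j _.
by rewrite mxE mul0r.
Qed.

Lemma min0_superadd u v : m u + m v <= m (u + v).
Proof.
have [i mini] := ex_minimal (u + v); rewrite (min0E mini) pairingD.
by apply: lerD; exact: min0_le.
Qed.

(** Moving from [z] a little in the direction opposite to [u] stays in the polytope
    and decreases [u]. *)
Lemma min0_lt_interior z u : interior P z -> u != 0 -> m u < pairing u z.
Proof.
move=> /interior_box[e e0 eP] u0; pose w : 'rV[R]_d := map_mx intr u.
have uw : 0 < pairing u w by exact: pairing_self_gt0.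
pose s := \sum_j `|w ord0 j| + 1.
have s1 : 0 < s by apply: ltr_pwDr => //; apply: sumr_ge0.
have Pz : P (z - (e / s) *: w).
  apply: eP => j; rewrite !mxE opprD addrA subrr add0r opprK normrM.
  rewrite ger0_norm ?divr_ge0 ?ltW// mulrAC ltr_pdivrMr// ltr_pM2l//.
  have : `|w ord0 j| <= \sum_j `|w ord0 j|.
    by rewrite (bigD1 j)//= lerDl sumr_ge0.
  by rewrite /s mxE; lra.
apply: le_lt_trans (min0_le_hull u Pz) _.
by rewrite pairingBr pairingZ ltrBlDr ltrDl mulr_gt0// divr_gt0.
Qed.

Section Generators.
Variables (N : int) (X : 'I_n.+1 -> V).
Hypothesis N_gt0 : 0 < N.
Hypothesis XE : forall i, map_mx intr (X i) = N%:~R *: p i.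
Hypothesis full : forall u, (forall i, pairing u (p i) = pairing u (p ord0)) -> u = 0.

(** The pairing with [p i], multiplied by the common denominator [N] so as to be an
    integer. *)
Definition level v i : int := \sum_j v ord0 j * X i ord0 j.

Lemma levelE v i : (level v i)%:~R = N%:~R * pairing v (p i).
Proof.
rewrite -pairingZ -XE /level /pairing rmorph_sum/=.
by apply: eq_bigr => j _; rewrite mxE intrM.
Qed.

(** The excess of the [i]-th point over the minimum of [v], as a natural number:
    [height v] lies in [N^(n+1)], where Dickson's lemma is available. *)
Definition height v i : nat :=
  `|level v i - level v (projT1 (cid (ex_minimal v)))|%N.

Lemma heightE v i : (height v i)%:R = N%:~R * (pairing v (p i) - m v) :> R.
Proof.
rewrite /height; case: cid => k /= mink.
rewrite natr_absz ger0_norm.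
  by rewrite intrB !levelE (min0E mink) mulrBr.
rewrite -(ler_int R) intrB !levelE -mulrBr mulr_ge0//.
  by rewrite ler0z ltW.
by rewrite subr_ge0 mink.
Qed.

Let N_gt0R : 0 < N%:~R :> R. Proof. by rewrite ltr0z. Qed.

(** A point where [v] is minimal has height 0 for [v], hence for [u]: it minimizes
    [u] too. The inequality of heights says that it minimizes also [v - u]. So [m]
    is additive on [u + (v - u)], and the heights subtract. *)
Lemma min0_additive u v : (forall i, (height u i <= height v i)%N) ->
  m v = m u + m (v - u) /\ forall i, height v i = (height u i + height (v - u) i)%N.
Proof.
move=> huv; have [i mini] := ex_minimal v.
have hv0 : height v i = 0%N.
  by apply: (mulrIn (oner_neq0 R)); rewrite heightE (min0E mini) subrr mulr0.
have hu0 : height u i = 0%N by apply/eqP; rewrite -leqn0 -hv0.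
have mu : m u = pairing u (p i).
  have /eqP := heightE u i; rewrite hu0 eq_sym mulf_eq0 gt_eqF//= subr_eq0.
  by move=> /eqP.
have pB j : pairing (v - u) (p j) = pairing v (p j) - pairing u (p j).
  by have := pairingD (v - u) u (p j); rewrite subrK => ->; rewrite addrK.
have le_huv j : pairing u (p j) - m u <= pairing v (p j) - m v.
  by rewrite -(ler_pM2l N_gt0R) -!heightE ler_nat.
have minB : minimal (v - u) i.
  by move=> j; rewrite !pB -mu -(min0E mini); have := le_huv j; lra.
have mB : m (v - u) = m v - m u by rewrite (min0E minB) pB -mu -(min0E mini).
split=> [|j]; first by rewrite mB; ring.
apply: (mulrIn (oner_neq0 R)); rewrite natrD !heightE mB pB; ring.
Qed.

Definition heights v : seq nat := [seq height v i | i <- enum 'I_n.+1].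

Lemma lev_heights u v : lev (heights u) (heights v) ->
  forall i, (height u i <= height v i)%N.
Proof.
move=> luv i; move: luv (mem_enum 'I_n.+1 i); rewrite /heights inE.
elim: (enum _) => //= k s IH; rewrite /lev /= => /andP[hk hs].
by rewrite inE => /orP[/eqP->//|]; exact: IH.
Qed.

Lemma lincomb_zero (us : seq V) : [/\ size (nseq (size us) 0%N) = size us,
  lincomb us (nseq (size us) 0%N) = 0 & wsum m us (nseq (size us) 0%N) = 0].
Proof. by elim: us => //= v s [-> -> ->]; rewrite !mulr0n !addr0. Qed.

Lemma lincomb_mem (us : seq V) u : u \in us -> exists x,
  [/\ size x = size us, lincomb us x = u & wsum m us x = m u].
Proof.
elim: us => //= w us IH; rewrite inE => /orP[/eqP->|/IH[x [sx lx wx]]].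
  have [sz lz wz] := lincomb_zero us; exists (1%N :: nseq (size us) 0%N) => /=.
  by rewrite sz lz wz !mulr1n !add0r.
by exists (0%N :: x); rewrite /= sx lx wx !mulr0n !addr0.
Qed.

(** Take generators whose heights form a finite basis of all heights of nonzero
    vectors. A nonzero [v] has heights above those of some generator, which can be
    subtracted; the sum of the heights drops, as only the zero vector has all
    heights 0. *)
Lemma generators : exists us : seq V, all (fun u => u != 0) us /\
  forall v, exists x,
    [/\ size x = size us, lincomb us x = v & m v = wsum m us x].
Proof.
have [|B [BS BP]] := @dickson n.+1 (heights @` [set v | v != 0]).
  by move=> _ [v _ <-]; rewrite size_map size_enum_ord.
have /choice[g gP] : forall b, exists u : V, b \in B -> u != 0 /\ heights u = b.
  move=> b; have [/BS[u u0 <-]|_] := boolP (b \in B); first by exists u.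
  by exists 0.
exists [seq g b | b <- B]; set us := [seq g b | b <- B].
split; first by apply/allP => _ /mapP[b /gP[? _] ->].
move=> v; have [k] := ubnP (\sum_i height v i)%N.
elim: k v => // k IH v hv.
have [->|v0] := eqVneq v 0.
  have [sz lz wz] := lincomb_zero us; exists (nseq (size us) 0%N).
  by rewrite sz lz wz min0_0.
have [|b bB bv] := BP (heights v); first by exists v.
have [g0 gE] := gP _ bB.
have [mE hE] := min0_additive (lev_heights (etrans (congr1 (fun c => lev c _) gE) bv)).
have hg : (0 < \sum_i height (g b) i)%N.
  rewrite lt0n sum_nat_eq0; apply/negP => /forallP hg0.
  have hg i : pairing (g b) (p i) = m (g b).
    have /eqP := heightE (g b) i; rewrite (eqP (hg0 i)) eq_sym mulf_eq0 gt_eqF//=.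
    by rewrite subr_eq0 => /eqP.
  by move/eqP: g0; apply; apply: full => i; rewrite !hg.
have [|x [sx lx mx]] := IH (v - g b).
  move: hv; rewrite (eq_bigr _ (fun i _ => hE i)) big_split/= ltnS.
  by apply: leq_trans; rewrite -[ltnLHS]add0n ltn_add2r.
have [e [se le we]] := lincomb_mem (map_f g bB).
exists (addns e x); rewrite size_addns ?se ?sx//; split => //.
  by rewrite lincomb_addns// le lx addrC subrK.
by rewrite wsum_addns// we -mx.
Qed.

End Generators.
End MinPairing.

(** * Full-dimensional and flat polytopes *)

Section Dimension.
Variables (R : realType) (d n : nat) (p : 'I_n.+1 -> 'rV[R]_d).
Local Notation V := 'rV[int]_d.
Implicit Types (u v : V) (i : 'I_n.+1) (x y : 'rV[R]_d).

Lemma affine_hull_hull x : affine_hull (hull p) x ->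
  exists a : 'I_n.+1 -> R, \sum_i a i = 1 /\ x = \sum_i a i *: p i.
Proof.
move=> [k [q [c [qP c1 ->]]]].
have /choice[b bP] : forall l, exists b : 'I_n.+1 -> R,
    \sum_i b i = 1 /\ q l = \sum_i b i *: p i.
  by move=> l; have [b [_ b1 ->]] := qP l; exists b.
exists (fun i => \sum_l c l * b l i); split.
  rewrite exchange_big -[RHS]c1/=; apply: eq_bigr => l _.
  by rewrite -mulr_sumr (bP l).1 mulr1.
under [RHS]eq_bigr do rewrite scaler_suml; rewrite exchange_big/=.
apply: eq_bigr => l _; rewrite {1}(bP l).2 scaler_sumr.
by apply: eq_bigr => i _; rewrite scalerA.
Qed.

(** A linear form that is constant on the points is constant on their affine hull,
    the whole space, hence is zero. *)
Lemma full_pairing_eq0 u : full_dimensional (hull p) ->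
  (forall i, pairing u (p i) = pairing u (p ord0)) -> u = 0.
Proof.
move=> full up.
have const x : pairing u x = pairing u (p ord0).
  have [a [a1 ->]] : exists a : 'I_n.+1 -> R,
      \sum_i a i = 1 /\ x = \sum_i a i *: p i.
    by apply: affine_hull_hull; rewrite full.
  rewrite pairing_sum; under eq_bigr do rewrite up.
  by rewrite -mulr_suml a1 mul1r.
apply/rowP => j; rewrite mxE; apply/eqP; rewrite -(intr_eq0 R) -pairing_delta.
by rewrite const -(const 0) pairing0r.
Qed.

(** The barycenter [b] is interior. Each basis vector is a combination of the [p i]
    with coefficients of sum 0, as [0] and the endpoint of the vector are affine
    combinations of them; so a small displacement from [b] perturbs the equal
    weights [c] by small amounts of sum 0. *)
Lemma full_interior : full_dimensional (hull p) -> interior (hull p) !=set0.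
Proof.
move=> full.
have aff x : exists a : 'I_n.+1 -> R, \sum_i a i = 1 /\ x = \sum_i a i *: p i.
  by apply: affine_hull_hull; rewrite full.
have [o [o1 oE]] := aff 0.
have /choice[a aP] := fun j : 'I_d => aff (delta_mx ord0 j).
pose D j i := a j i - o i.
have D0 j : \sum_i D j i = 0 by rewrite sumrB (aP j).1 o1 subrr.
have DE j : delta_mx ord0 j = \sum_i D j i *: p i.
  under eq_bigr do rewrite scalerBl; rewrite sumrB -oE subr0.
  exact: (aP j).2.
pose c : R := n.+1%:R^-1.
have c0 : 0 < c by rewrite invr_gt0.
pose b := \sum_i c *: p i.
pose S := \sum_j \sum_i `|D j i| + 1.
have S0 : 0 < S.
  by apply: ltr_pwDr => //; apply: sumr_ge0 => j _; apply: sumr_ge0.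
exists b; apply/interior_box; exists (c / S); first exact: divr_gt0.
move=> y yb; pose w j := y ord0 j - b ord0 j.
exists (fun i => c + \sum_j w j * D j i); split.
- move=> i; suff : `|\sum_j w j * D j i| <= c by rewrite ler_norml; lra.
  apply: le_trans (ler_norm_sum _ _ _) _.
  apply: (@le_trans _ _ (\sum_j (c / S) * `|D j i|)).
    apply: ler_sum => j _; rewrite normrM; apply: ler_wpM2r => //.
    by rewrite distrC ltW.
  rewrite -mulr_sumr -mulrA ger_pMr// mulrC ler_pdivrMr// mul1r.
  have : \sum_j `|D j i| <= \sum_j \sum_i `|D j i|.
    by apply: ler_sum => j _; rewrite [leRHS](bigD1 i)//= lerDl sumr_ge0.
  by rewrite /S; lra.
- rewrite big_split/= exchange_big/= sumr_const card_ord -[X in X + _]mulr_natr.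
  rewrite /c mulVf ?pnatr_eq0// big1 ?addr0// => j _.
  by rewrite -mulr_sumr D0 mulr0.
- have -> : y = b + \sum_j w j *: delta_mx ord0 j.
    rewrite -[LHS](subrK b) addrC; congr (_ + _).
    rewrite [LHS]row_sum_delta; apply: eq_bigr => j _.
    by rewrite !mxE.
  under [in RHS]eq_bigr do rewrite scalerDl; rewrite big_split/=; congr (_ + _).
  under [RHS]eq_bigr do rewrite scaler_suml; rewrite exchange_big/=.
  apply: eq_bigr => j _; rewrite DE scaler_sumr.
  by apply: eq_bigr => i _; rewrite scalerA.
Qed.

(** If the differences [X i - X 0] had rank [d] over the rationals, they would span
    the real space, and the affine hull would be everything. Otherwise some
    nonzero rational vector is orthogonal to them; clear its denominators. *)
Lemma flat_direction (N : int) (X : 'I_n.+1 -> V) : 0 < N ->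
  (forall i, map_mx intr (X i) = N%:~R *: p i) -> ~ full_dimensional (hull p) ->
  exists2 u, u != 0 & forall i, pairing u (p i) = pairing u (p ord0).
Proof.
move=> N0 XE nfull.
have NR0 : N%:~R != 0 :> R by rewrite intr_eq0 gt_eqF.
pose A : 'M[rat]_(n.+1, d) := \matrix_(i, j) (X i ord0 j - X ord0 ord0 j)%:~R.
pose AR : 'M[R]_(n.+1, d) := map_mx ratr A.
have AE i : row i AR = N%:~R *: (p i - p ord0).
  rewrite scalerBr -!XE; apply/rowP => j.
  by rewrite !mxE ratr_int intrB.
have nfullA : ~~ row_full A.
  apply/negP => fullA; apply: nfull; apply/seteqP; split => // x _.
  have fullAR : row_full AR by rewrite /AR row_full_map.
  have /submxP[D DE] := submx_full (x - p ord0) fullAR.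
  pose c i := N%:~R * D ord0 i.
  have [s sE] : exists s, s = 1 - \sum_k c k by exists (1 - \sum_k c k).
  exists n.+1, p, (fun i => c i + s * (i == ord0)%:R).
  have dlt : \sum_(i < n.+1) s * (i == ord0)%:R = s.
    rewrite (bigD1 ord0)//= mulr1 big1 ?addr0// => i /negbTE ->.
    by rewrite mulr0.
  split; first by move=> i; exact: hull_mem.
    by rewrite big_split/= dlt sE; ring.
  under eq_bigr do rewrite scalerDl; rewrite big_split/=.
  rewrite [X in _ + X](_ : _ = s *: p ord0); last first.
    rewrite (bigD1 ord0)//= mulr1 big1 ?addr0// => i /negbTE ->.
    by rewrite mulr0 scale0r.
  have : x - p ord0 = \sum_i c i *: p i - (\sum_i c i) *: p ord0.
    rewrite DE mulmx_sum_row scaler_suml -sumrB; apply: eq_bigr => i _.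
    by rewrite AE scalerA -scalerBr mulrC.
  move=> /(canRL (subrK _)) ->.
  by rewrite sE scalerBl scale1r addrA addrAC.
have [r r0 rA] : exists2 r : 'rV[rat]_d, r != 0 & r *m A^T = 0.
  have : kermx A^T != 0.
    by rewrite kermx_eq0 -row_leq_rank -ltnNge mxrank_tr ltn_neqAle rank_leq_col andbT.
  by move=> /rowV0Pn[r /sub_kermxP rA r0]; exists r.
have [M [U [M0 UE]]] := @rational_points_scale R d 1 (fun=> map_mx ratr r)
  (fun _ j => ex_intro _ (r ord0 j) (mxE _ _ _ _)).
have MR0 : M%:~R != 0 :> R by rewrite intr_eq0 gt_eqF.
exists (U ord0).
  apply: contra_neq r0 => U0; have := UE ord0; rewrite U0 => /rowP rE.
  apply/rowP => j; have /eqP := rE j.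
  rewrite !mxE mulr0z eq_sym mulf_eq0 (negbTE MR0)/=.
  by rewrite fmorph_eq0 => /eqP.
move=> i; apply/eqP; rewrite -subr_eq0 -pairingBr.
have E : pairing (U ord0) (N%:~R *: (p i - p ord0)) = 0.
  rewrite -AE /pairing.
  transitivity (M%:~R * ratr ((r *m A^T) ord0 i) : R); last first.
    by rewrite rA mxE rmorph0 mulr0.
  rewrite mxE rmorph_sum/= mulr_sumr; apply: eq_bigr => j _.
  have /rowP/(_ j) := UE ord0; rewrite !mxE => ->.
  by rewrite -mulrA; congr (_ * _); rewrite rmorphM.
by move/eqP: E; rewrite pairingZ mulf_eq0 (negbTE NR0).
Qed.

End Dimension.

(** * Linear relations between compact convex sets *)

Section CompactConvexRelations.
Variable R : realType.

Lemma below_gap (s : seq R) t :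
  exists2 t', t' < t & forall x, x \in s -> x < t -> x < t'.
Proof.
elim: s => [|x s [t' t't sP]]; first by exists (t - 1); first lra.
have [xt|tx] := ltP x t; last first.
  exists t' => // y; rewrite inE => /orP[/eqP->|]; last exact: sP.
  by move=> /lt_le_trans/(_ tx); rewrite ltxx.
have [xt'|t'x] := ltP x t'.
  by exists t' => // y; rewrite inE => /orP[/eqP->//|]; exact: sP.
exists ((x + t) / 2); first by lra.
move=> y; rewrite inE => /orP[/eqP->|/sP ys /ys yt]; lra.
Qed.

Lemma sum_fibers (I : finType) (J : pred I) (alpha lo : I -> R) (h : R -> R) :
  (forall t, \sum_(i | J i && (lo i == t)) alpha i = 0) ->
  \sum_(i | J i) alpha i * h (lo i) = 0.
Proof.
move=> fib; pose U := undup [seq lo i | i <- enum I].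
transitivity (\sum_(i | J i) \sum_(t <- U | lo i == t) alpha i * h t).
  apply: eq_bigr => i _.
  rewrite big_mkcond (bigD1_seq (lo i)) ?undup_uniq//=; last first.
    by rewrite mem_undup map_f// mem_enum.
  by rewrite eqxx big1 ?addr0// => t /negbTE; rewrite eq_sym => ->.
rewrite (exchange_big_dep predT)//= big1// => t _.
by rewrite -mulr_suml fib mul0r.
Qed.

(** Compare the relation at [t] with the one at a point just below [t]: the
    intervals that contain exactly one of the two points are those that start at
    [t]. So the coefficients of the intervals starting at [t] have sum 0. *)
Lemma interval_cancel (I : finType) (J : pred I) (alpha lo hi : I -> R) (h : R -> R) :
  (forall i, J i -> lo i <= hi i) ->
  (forall t, \sum_(i | J i && (lo i <= t <= hi i)) alpha i = 0) ->
  \sum_(i | J i) alpha i * h (lo i) = 0.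
Proof.
move=> lohi slices; apply: sum_fibers => // t.
have [t' t't gap] :=
  below_gap ([seq lo i | i <- enum I] ++ [seq hi i | i <- enum I]) t.
have loP i : lo i < t -> lo i < t' by apply: gap; rewrite mem_cat map_f// mem_enum.
have hiP i : hi i < t -> hi i < t'.
  by apply: gap; rewrite mem_cat map_f ?orbT// mem_enum.
have := slices t; rewrite (bigID (fun i => lo i == t))/=.
rewrite [X in _ + X](_ : _ = 0) ?addr0.
  move=> E; rewrite -[RHS]E; apply: eq_bigl => i; case Ji: (J i) => //=.
  by case: eqP => [<-|_]; rewrite ?andbF//= lexx lohi.
rewrite -[RHS](slices t'); apply: eq_bigl => i; rewrite -andbA; congr (_ && _).
apply/idP/idP => [/andP[/andP[lt th] nlt]|/andP[lt' t'h]].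
  have /loP : lo i < t by rewrite lt_neqAle nlt.
  by move=> /ltW ->/=; lra.
have lt : lo i < t by lra.
rewrite (ltW lt) (lt_eqF lt) andbT/= leNgt; apply/negP => /hiP; lra.
Qed.

Variable d : nat.
Local Notation V := 'rV[R]_d.
Implicit Types (C : set V) (v : 'rV[int]_d).

Definition convex_set C := forall x y (t : R), C x -> C y -> 0 <= t <= 1 ->
  C (t *: x + (1 - t) *: y).

Lemma pairing_continuous v : continuous (fun x : V => pairing v x).
Proof.
rewrite /pairing; apply: (@continuous_big _ _ +%R 0 predT) => [|j _].
  exact: add_continuous.
move=> x; apply: (@cvgMl_tmp R V (nbhs x) _ (fun y : V => y ord0 j)).
exact: (@coord_continuous R 1 d ord0 j x).
Qed.

Lemma pairing_range v C : compact C -> C !=set0 -> exists x y, [/\ C x, C y,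
  forall z, C z -> pairing v x <= pairing v z &
  forall z, C z -> pairing v z <= pairing v y].
Proof.
move=> cC C0; have cf := continuous_subspaceT (A := C) (@pairing_continuous v).
have [x Cx xP] := compact_EVT_min C0 cC cf.
have [y Cy yP] := compact_EVT_max C0 cC cf.
by exists x, y; split=> [||z Cz|z Cz];
  [rewrite inE in Cx|rewrite inE in Cy|apply: xP; rewrite inE|apply: yP; rewrite inE].
Qed.

(** The slice of [C i] at height [t] is nonempty exactly when [t] lies between the
    minimum and the maximum of [v] on [C i], by compactness and convexity; so the
    hypothesis is a relation between the intervals that are the images of [v]. *)
Lemma slice_relation (I : finType) (J : pred I) (C : I -> set V)
    (alpha lo : I -> R) v (h : R -> R) :
  (forall i, J i -> compact (C i)) -> (forall i, J i -> convex_set (C i)) ->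
  (forall i, J i -> exists x, [/\ C i x, pairing v x = lo i &
     forall y, C i y -> lo i <= pairing v y]) ->
  (forall t, \sum_(i | J i && `[< C i `&` [set x | pairing v x = t] !=set0 >])
     alpha i = 0) ->
  \sum_(i | J i) alpha i * h (lo i) = 0.
Proof.
move=> cC vC loP slices.
have /choice[hi hiP] : forall i, exists s, J i ->
    exists y, [/\ C i y, pairing v y = s &
    forall z, C i z -> pairing v z <= s].
  move=> i; case Ji: (J i); last by exists 0.
  have [x [Cx _ _]] := loP _ Ji.
  have [_ [y [_ Cy _ yP]]] := pairing_range v (cC _ Ji) (ex_intro _ x Cx).
  by exists (pairing v y) => _; exists y.
have lohi i : J i -> lo i <= hi i.
  by move=> /[dup] /loP[x [Cx <- _]] /hiP[y [_ _]]; exact.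
apply: (@interval_cancel _ J alpha lo hi h lohi) => t; rewrite -[RHS](slices t).
apply: eq_bigl => i; case Ji: (J i) => //=.
have [x [Cx xlo loy]] := loP _ Ji; have [y [Cy yhi hiy]] := hiP _ Ji.
apply/idP/asboolP => [/andP[lt th]|[z [Cz <-]]]; last by rewrite loy ?hiy.
have [E|ne] := eqVneq (lo i) (hi i).
  by exists x; split => //=; rewrite xlo; apply/eqP; rewrite eq_le lt E th.
have lh : 0 < hi i - lo i by rewrite subr_gt0 lt_neqAle ne lohi.
pose s := (hi i - t) / (hi i - lo i).
exists (s *: x + (1 - s) *: y); split.
  apply: vC => //; rewrite divr_ge0 ?(ltW lh) ?subr_ge0//=.
  by rewrite ler_pdivrMr// mul1r lerD2l lerN2.
by rewrite /= pairingDr !pairingZ xlo yhi /s; field; rewrite gt_eqF.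
Qed.

Lemma slice_indicators (I : finType) (J : pred I) (C : I -> set V)
    (alpha : I -> R) v t :
  (forall x, \sum_(i | J i) alpha i * \1_(C i) x = 0) -> forall x,
  \sum_(i | J i && `[< C i `&` [set y | pairing v y = t] !=set0 >])
    alpha i * \1_(C i `&` [set y | pairing v y = t]) x = 0.
Proof.
move=> rel x; have [xt|xt] := eqVneq (pairing v x) t; last first.
  rewrite big1// => i _; rewrite indicE memNset ?mulr0// => -[_ /= E].
  by rewrite E eqxx in xt.
rewrite -[RHS](rel x) big_mkcondr/=; apply: eq_bigr => i Ji.
have [Cx|nCx] := pselect (C i x).
  by rewrite asboolT ?indicE ?mem_set//; exists x.
rewrite [in RHS]indicE memNset// mulr0; case: ifP => // _.
by rewrite indicE memNset ?mulr0// => -[].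
Qed.

Lemma closed_pairing_eq v t : closed [set x : V | pairing v x = t].
Proof.
have /continuous_closedP := @pairing_continuous v.
by move=> /(_ _ (@closed_eq R t)).
Qed.

(** The existence of the Euler characteristic, in the form that it takes on compact
    convex sets. Induction on the number [k] of free coordinates: the slices by
    [x_k = t] have one free coordinate less and inherit the relation, so
    [slice_relation] applies with the constant function 1. *)
Lemma euler_relation (I : finType) (J : pred I) (C : I -> set V) (alpha : I -> R) :
  (forall i, J i -> compact (C i)) -> (forall i, J i -> convex_set (C i)) ->
  (forall i, J i -> C i !=set0) ->
  (forall x, \sum_(i | J i) alpha i * \1_(C i) x = 0) ->
  \sum_(i | J i) alpha i = 0.
Proof.
suff H k : (k <= d)%N -> forall (w : V) (J : pred I) (C : I -> set V),
    (forall i, J i -> compact (C i)) -> (forall i, J i -> convex_set (C i)) ->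
    (forall i, J i -> C i !=set0) ->
    (forall i x (j : 'I_d), J i -> C i x -> (k <= j)%N -> x ord0 j = w ord0 j) ->
    (forall x, \sum_(i | J i) alpha i * \1_(C i) x = 0) ->
    \sum_(i | J i) alpha i = 0.
  move=> cC vC C0 rel; apply: (H d (leqnn d) 0 J C) => // i x j _ _.
  by rewrite leqNgt ltn_ord.
elim: k => [|k IH] kd w {}J {}C cC vC C0 Cw rel.
  rewrite -[RHS](rel w); apply: eq_bigr => i Ji; rewrite indicE mem_set ?mulr1//.
  have [x Cx] := C0 i Ji; suff -> : w = x by [].
  by apply/rowP => j; rewrite (Cw i x j).
pose v : 'rV[int]_d := delta_mx ord0 (Ordinal kd).
have vE (x : V) : pairing v x = x ord0 (Ordinal kd).
  rewrite /pairing (bigD1 (Ordinal kd))//= mxE !eqxx mul1r big1 ?addr0// => j jk.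
  by rewrite mxE eqxx (negbTE jk) mul0r.
have /choice[lo loP] : forall i, exists s, J i ->
    exists x, [/\ C i x, pairing v x = s &
    forall y, C i y -> s <= pairing v y].
  move=> i; case Ji: (J i); last by exists 0.
  have [x [_ [Cx _ xP _]]] := pairing_range v (cC _ Ji) (C0 _ Ji).
  by exists (pairing v x) => _; exists x.
rewrite -[LHS](_ : \sum_(i | J i) alpha i * 1 = _); last first.
  by apply: eq_bigr => i _; rewrite mulr1.
apply: (@slice_relation _ J C alpha lo v (fun=> 1)) => // t.
pose w' : V := \row_j (if j == Ordinal kd then t else w ord0 j).
apply: (IH (ltnW kd) w' _ (fun i => C i `&` [set x | pairing v x = t])).
- move=> i /andP[Ji _]; apply: compact_closedI; first exact: cC.
  exact: closed_pairing_eq.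
- move=> i /andP[Ji _] x y s [Cx /= xt] [Cy /= yt] s01; split; first exact: vC.
  by rewrite /= pairingDr !pairingZ xt yt; ring.
- by move=> i /andP[_ /asboolP].
- move=> i x j /andP[Ji _] [Cx /= xt] kj; rewrite mxE.
  case: eqVneq => [->|jk]; first by rewrite -vE.
  apply: Cw Ji Cx _; rewrite ltn_neqAle kj andbT eq_sym.
  by apply: contra_neqN jk => /eqP jk; apply/val_inj.
- exact: slice_indicators.
Qed.

(** Any function of the minimum of [v] is a valuation: the Euler relation for the
    slices by [v] is what [slice_relation] needs. *)
Lemma min_pairing_relation (I : finType) (J : pred I) (C : I -> set V)
    (alpha : I -> R) v (lo : I -> R) (h : R -> R) :
  (forall i, J i -> compact (C i)) -> (forall i, J i -> convex_set (C i)) ->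
  (forall i, J i -> exists x, [/\ C i x, pairing v x = lo i &
     forall y, C i y -> lo i <= pairing v y]) ->
  (forall x, \sum_(i | J i) alpha i * \1_(C i) x = 0) ->
  \sum_(i | J i) alpha i * h (lo i) = 0.
Proof.
move=> cC vC loP rel; apply: (@slice_relation _ J C alpha lo v h cC vC loP) => t.
apply: (@euler_relation _ _ (fun i => C i `&` [set x | pairing v x = t])).
- move=> i /andP[Ji _]; apply: compact_closedI; first exact: cC.
  exact: closed_pairing_eq.
- move=> i /andP[Ji _] x y s [Cx /= xt] [Cy /= yt] s01; split; first exact: vC.
  by rewrite /= pairingDr !pairingZ xt yt; ring.
- by move=> i /andP[_ /asboolP].
- exact: slice_indicators.
Qed.

End CompactConvexRelations.

(** * The dual lattice function *)

Lemma base_digits_inj d (B : nat) (a b : 'I_d -> nat) :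
  (forall i, a i < B)%N -> (forall i, b i < B)%N ->
  (\sum_i a i * B ^ i = \sum_i b i * B ^ i)%N -> a =1 b.
Proof.
elim: d a b => [|d IH] a b aB bB; first by move=> _ [].
rewrite !big_ord_recl !expn0 !muln1.
have shift (c : 'I_d.+1 -> nat) : (\sum_(i < d) c (lift ord0 i) * B ^ bump 0 i =
    (\sum_(i < d) c (lift ord0 i) * B ^ i) * B)%N.
  by rewrite big_distrl/=; apply: eq_bigr => i _; rewrite /bump/= add1n expnSr mulnA.
rewrite !shift => E.
have E0 : a ord0 = b ord0.
  have := congr1 (modn^~ B) E.
  by rewrite ![(_ ord0 + _)%N]addnC !modnMDl !modn_small.
have ES : (\sum_(i < d) a (lift ord0 i) * B ^ i =
           \sum_(i < d) b (lift ord0 i) * B ^ i)%N.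
  have B0 : (0 < B)%N by apply: leq_ltn_trans (aB ord0).
  by move/eqP: E; rewrite E0 eqn_add2l eqn_pmul2r// => /eqP.
have H := IH _ _ (fun i => aB _) (fun i => bB _) ES.
by move=> i; case: (unliftP ord0 i) => [j ->|->//]; exact: H.
Qed.

(** Kronecker's substitution [y_i s^(B^i)]: distinct monomials of [p] become
    distinct powers of [s], by uniqueness of digits in base [B], and a polynomial
    in [s] with infinitely many roots is zero. *)
Lemma mpoly_curve_eq0 (R : realType) d (B : nat) (p : mpoly d R) (y : 'I_d -> R)
    (s : nat -> R) :
  (forall m : multinom d, m \in msupp p -> forall i, (m i < B)%N) ->
  (forall i, y i != 0) -> injective s ->
  (forall k, meval (fun i => y i * s k ^+ (B ^ i)) p = 0) -> p = 0.
Proof.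
move=> mB y0 sinj vanish.
pose kap (m : multinom d) := (\sum_i m i * B ^ i)%N.
pose c m := mcoeff m p * \prod_i y i ^+ m i.
pose Q : {poly R} := \sum_(m <- msupp p) c m *: 'X^(kap m).
have QE k : Q.[s k] = 0.
  rewrite -[RHS](vanish k) mevalE horner_sum; apply: eq_bigr => m _.
  rewrite hornerZ hornerXn /c -mulrA; congr (_ * _).
  rewrite /kap expr_sum -big_split/=; apply: eq_bigr => i _.
  by rewrite exprMn -exprM mulnC.
have Q0 : Q = 0.
  apply/eqP; apply: contraT => Qn0.
  have := max_poly_roots Qn0 (rs := [seq s k | k <- iota 0 (size Q)]).
  rewrite size_map size_iota ltnn map_inj_uniq// iota_uniq => H.
  suff: false by []; apply: H => //.
  by apply/allP => _ /mapP[k _ ->]; rewrite /root QE.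
apply/mpolyP => m; rewrite mcoeff0; apply/eqP; rewrite mcoeff_eq0; apply/negP => mp.
have : Q`_(kap m) = c m.
  rewrite coef_sum (bigD1_seq m) ?msupp_uniq//= coefZ coefXn eqxx mulr1.
  rewrite big_seq_cond big1 ?addr0// => m' /andP[m'p m'm].
  rewrite coefZ coefXn; case: eqP => [E|_]; last by rewrite mulr0.
  case/eqP: m'm; apply/mnmP => i; symmetry.
  exact: base_digits_inj (mB _ mp) (mB _ m'p) E i.
rewrite Q0 coef0 => /esym/eqP; rewrite mulf_eq0 => /orP[|].
  by rewrite mcoeff_eq0 mp.
by move=> /prodf_eq0[i _]; rewrite expf_eq0 (negbTE (y0 i)) andbF.
Qed.

Lemma full_nonempty (R : realType) d (P : set 'rV[R]_d) :
  full_dimensional P -> P !=set0.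
Proof.
move=> fP; have [k [q [c [qP c1 _]]]] : affine_hull P 0 by rewrite fP.
case: k q c qP c1 => [|k] q c qP c1; last by exists (q ord0); exact: qP.
by move/eqP: c1; rewrite big_ord0 eq_sym oner_eq0.
Qed.

Section Uniqueness.
Variables (R : realType) (d : nat) (y0 : R).
Hypothesis y0_gt1 : 1 < y0.
Local Notation poly := (mpoly d R).
Local Notation ratfun := {fraction poly}.
Let y0_gt0 : 0 < y0. Proof. exact: lt_trans y0_gt1. Qed.

Lemma mpoly_box_eq0 (p : poly) (z0 : 'rV[R]_d) (e : R) : 0 < e ->
  (forall z : 'rV[R]_d, (forall j, `|z0 ord0 j - z ord0 j| < e) ->
     meval (fun i => y0 `^ z ord0 i) p = 0) -> p = 0.
Proof.
move=> e0 vanish.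
pose B := (\max_(m <- msupp p) mdeg m).+1.
pose K : R := (B ^ d)%:R.
have K0 : 0 < K by rewrite ltr0n expn_gt0.
(* The parameter [s = y0^(t k)] moves the exponent [z0_i] by [t k * B^i], which
   has to stay below [e]. *)
pose t (k : nat) : R := e / (2 * K) / k.+1%:R.
apply: (@mpoly_curve_eq0 _ _ B _ (fun i => y0 `^ z0 ord0 i) (fun k => y0 `^ t k)).
- move=> m mp i; rewrite ltnS; apply: (@leq_trans (mdeg m)).
    by rewrite mdegE (bigD1 i)//= leq_addr.
  exact: (@leq_bigmax_seq _ _ predT).
- by move=> i; rewrite gt_eqF// powR_gt0.
- move=> k l /(congr1 (@ln R)); rewrite !ln_powR => /(mulIf _).
  rewrite gt_eqF ?ln_gt0// => /(_ isT).
  have nz : e / (2 * K) != 0 by rewrite gt_eqF// divr_gt0// mulr_gt0.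
  move=> /(mulfI nz)/invr_inj/eqP; rewrite eqr_nat => /eqP [].
  by [].
- move=> k; rewrite -[RHS](vanish (\row_j (z0 ord0 j + t k * (B ^ j)%:R))).
    apply: meval_eq => i; rewrite !mxE powRD ?(gt_eqF y0_gt0) ?implybT//.
    by rewrite powRrM powR_mulrn// powR_ge0.
  move=> j; rewrite mxE opprD addrA subrr add0r normrN.
  have tk0 : 0 <= t k by rewrite !divr_ge0// ?mulr_ge0// ltW.
  rewrite ger0_norm; last by rewrite mulr_ge0.
  apply: (@le_lt_trans _ _ (e / (2 * K) * K)); last first.
    by rewrite invfM mulrA mulfVK ?gt_eqF//; lra.
  apply: ler_pM => //.
    rewrite /t ler_pdivrMr// ler_peMr// ?ler1n// divr_ge0 ?ltW// mulr_gt0//.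
  by rewrite ler_nat leq_pexp2l// ltnW.
Qed.

(** The difference [h] of the two functions has value 0 at all points coming from
    the interior; so the numerator of a fraction for [h] vanishes on a box in the
    exponents [z], hence is zero. *)
Lemma represents_unique (P : set 'rV[R]_d) (f g : ratfun) : interior P !=set0 ->
  represents_dual_lattice_sum y0 P f -> represents_dual_lattice_sum y0 P g ->
  f = g.
Proof.
move=> [z0 z0P] fP gP; pose h := f + ratfun_const d (- 1) * g.
have hE : h = f - g by rewrite /h ratfun_constN ratfun_const1 mulN1r.
pose Y (z : 'rV[R]_d) i := y0 `^ z ord0 i.
have h0 z : interior P z -> ratfun_value h (Y z) 0.
  move=> /[dup] /fP[a [aE fa]] /gP[b [bE gb]].
  have ab : a = b by apply: EFin_inj; rewrite -aE -bE.
  have -> : 0 = a + (- 1) * b by rewrite ab; ring.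
  apply: ratfun_valueD fa _; apply: ratfun_valueM gb.
  exact: ratfun_value_const.
have [p [q [hpq q0 _]]] := h0 _ z0P.
have pE : FracField.tofrac p = h * FracField.tofrac q.
  by rewrite hpq; apply/esym/divfK/(tofrac_neq0 q0).
have /interior_box[e e0 eP] : interior (interior P) z0.
  exact: nbhs_interior z0P.
have p0 : p = 0.
  apply: (mpoly_box_eq0 e0) => z /eP zP.
  apply: (ratfun_value_uniq (ratfun_value_tofrac p _)).
  rewrite pE -[0](mul0r (meval (Y z) q)).
  exact: ratfun_valueM (h0 _ zP) (ratfun_value_tofrac q _).
by apply/eqP; rewrite -subr_eq0 -hE hpq p0 tofrac0 mul0r.
Qed.

(** The function built by [tame_setT] is the formal sum and has the values that
    define the dual lattice function, which it therefore equals. *)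
Lemma full_series (P : set 'rV[R]_d) : rational_polytope P -> full_dimensional P ->
  sums_to (fun v => y0 `^ min_pairing P 0 v) (dual_lattice_fun y0 P).
Proof.
move=> rP fP.
have P0 := full_nonempty fP.
have [n [p [N [X [PE N0 XE]]]]] := rational_polytope_points rP P0.
subst P.
have [us [us0 gen]] := generators N0 XE (fun u => full_pairing_eq0 fP).
have [f [fsum fval]] := tame_setT y0_gt1 (min0_0 p)
  (@min0_lt_interior _ _ _ p) (min0_superadd p) us0 gen.
have rf : represents_dual_lattice_sum y0 (hull p) f.
  move=> z /fval[a [aE fa]]; exists a; split => //; rewrite -aE.
  by apply: eq_esum => v _; rewrite min_pairing_shift.
have -> : dual_lattice_fun y0 (hull p) = f.
  apply: (represents_unique (full_interior fP) _ rf).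
  exact: (xgetPex 0 (ex_intro _ f rf)).
by apply: sums_to_eq fsum => v; rewrite indicT mul1r.
Qed.

(** With [u] constant on [P], the minimum of [v + u] is that of [v] plus this
    constant. So the series satisfies the geometric equation of ratio
    [y0^(m u) y^(-u)] started at the zero series. *)
Lemma flat_series (P : set 'rV[R]_d) : rational_polytope P -> P !=set0 ->
  ~ full_dimensional P -> sums_to (fun v => y0 `^ min_pairing P 0 v) 0.
Proof.
move=> rP P0 nfP.
have [n [p [N [X [PE N0 XE]]]]] := rational_polytope_points rP P0.
subst P; have [u u0 uE] := flat_direction N0 XE nfP.
have mu : min_pairing (hull p) 0 u = pairing u (p ord0).
  by apply: min0E => j; rewrite uE.
have mD v : min_pairing (hull p) 0 (v + u) =
    min_pairing (hull p) 0 v + min_pairing (hull p) 0 u.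
  have [i mini] := ex_minimal p v.
  rewrite (min0E mini) mu -(uE i) -pairingD; apply: min0E => j.
  by rewrite !pairingD !uE lerD2r; exact: mini.
pose c := y0 `^ min_pairing (hull p) 0 u.
have := @sums_to_geom R d c u (fun=> 0) (fun v => y0 `^ min_pairing (hull p) 0 v) 0
  (sums_to0 R d) _ (geom_neq0 y0_gt1 c u0).
rewrite mul0r; apply => v.
rewrite -[in X in X - _](subrK u v) mD powRD ?(gt_eqF y0_gt0) ?implybT//.
by rewrite mulrC subrr.
Qed.

End Uniqueness.

Lemma sums_to_sum (R : realType) d (I : finType) (J : pred I) (alpha : I -> R)
    (F : I -> 'rV[int]_d -> R) (f : I -> {fraction mpoly d R}) :
  (forall i, J i -> sums_to (F i) (f i)) ->
  sums_to (fun v => \sum_(i | J i) alpha i * F i v)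
    (\sum_(i | J i) ratfun_const d (alpha i) * f i).
Proof.
move=> FJ; rewrite -big_filter.
apply: (@sums_to_eq _ _
  (fun v => \sum_(i <- [seq i <- index_enum I | J i]) alpha i * F i v)).
  by move=> v; rewrite big_filter.
have : all J [seq i <- index_enum I | J i] by exact: filter_all.
elim: [seq i <- index_enum I | J i] => [_|i s IH /= /andP[Ji Js]].
  rewrite big_nil; apply: sums_to_eq (sums_to0 R d) => v; by rewrite big_nil.
rewrite big_cons; apply: sums_to_eq (sums_to_lin (alpha i) (FJ i Ji) (IH Js)) => v.
by rewrite big_cons.
Qed.

Section HullTopology.
Variables (R : realType) (d n : nat) (p : 'I_n -> 'rV[R]_d).

Lemma hull_convex : convex_set (hull p).
Proof.
move=> _ _ t [a [a0 a1 ->]] [b [b0 b1 ->]] /andP[t0 t1].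
exists (fun i => t * a i + (1 - t) * b i); split.
- by move=> i; rewrite addr_ge0// mulr_ge0// subr_ge0.
- by rewrite big_split/= -!mulr_sumr a1 b1; ring.
- rewrite !scaler_sumr -big_split/=; apply: eq_bigr => i _.
  by rewrite !scalerA -scalerDl.
Qed.

(** The hull is the image of the standard simplex under a continuous map. *)
Lemma hull_compact : compact (hull p).
Proof.
pose one : 'rV[int]_n := const_mx 1.
have oneE (c : 'rV[R]_n) : pairing one c = \sum_i c ord0 i.
  by apply: eq_bigr => i _; rewrite mxE mul1r.
pose S : set 'rV[R]_n := [set c : 'rV[R]_n | forall i, c ord0 i \in `[0, 1]]
  `&` [set c | pairing one c = 1].
have cS : compact S.
  apply: compact_closedI; last exact: closed_pairing_eq.
  have H := @rV_compact R n (fun=> [set x : R | x \in `[0, 1]]).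
  by apply: H => i; exact: segment_compact.
rewrite (_ : hull p = (fun c : 'rV[R]_n => \sum_i c ord0 i *: p i) @` S).
  apply: continuous_compact cS; apply: continuous_subspaceT.
  have addc : continuous (fun x : 'rV[R]_d * 'rV[R]_d => x.1 + x.2).
    by move=> x; exact: add_continuous.
  have H := @continuous_big 'rV[R]_d 'I_n +%R 0 predT addc
    'rV[R]_n (index_enum _) (fun i c => c ord0 i *: p i).
  apply: H => i _ c; apply: (@continuous_comp _ _ _ (fun c : 'rV[R]_n => c ord0 i)
    (fun t : R => t *: p i)); first exact: (@coord_continuous R 1 n ord0 i c).
  exact: scalel_continuous.
apply/seteqP; split => [x [c [c0 c1 ->]]|_ [c [c01 c1] <-]].
  exists (\row_i c i); last by apply: eq_bigr => i _; rewrite mxE.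
  split => [i|]; rewrite /= ?oneE.
    rewrite mxE in_itv/= c0 -c1 (bigD1 i)//= lerDl; exact: sumr_ge0.
  by rewrite -[RHS]c1; apply: eq_bigr => i _; rewrite mxE.
exists (fun i => c ord0 i); split => //.
  by move=> i; have := c01 i; rewrite /= in_itv/= => /andP[].
by rewrite -oneE.
Qed.

End HullTopology.

Theorem theorem4p1 (R : realType) (d : nat) (y0 : R) (hy0 : 1 < y0)
    (r a : nat) (har : (a <= r)%N)
    (P : 'I_r -> set 'rV[R]_d) (alpha : 'I_r -> R)
    (hP : forall i, rational_polytope (P i))
    (hfull : forall i : 'I_r, (i < a)%N -> full_dimensional (P i))
    (hlow : forall i : 'I_r, (a <= i)%N -> ~ full_dimensional (P i))
    (hsum : forall x : 'rV[R]_d, \sum_(i < r) alpha i * \1_(P i) x = 0) :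
  \sum_(i < r | (i < a)%N)
     ratfun_const d (alpha i) * dual_lattice_fun y0 (P i) = 0.
Proof.
pose J (i : 'I_r) := `[< P i !=set0 >].
(* The sum of the series of [P i], which is 0 for a flat polytope. The empty ones
   are left out, because the minimum of a form on them is only a default value. *)
pose K (i : 'I_r) := if (i < a)%N then dual_lattice_fun y0 (P i) else 0.
have KJ i : J i -> sums_to (fun v => y0 `^ min_pairing (P i) 0 v) (K i).
  move=> /asboolP P0; rewrite /K; case: ltnP => ia.
    exact: full_series (hP i) (hfull i ia).
  exact: flat_series (hP i) P0 (hlow i ia).
have Pcompact i : compact (P i).
  by have [[s ->] _] := hP i; exact: (@hull_compact R d _ (fun k => s`_k)).
have Pconvex i : convex_set (P i).
  by have [[s ->] _] := hP i; exact: (@hull_convex R d _ (fun k => s`_k)).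
have K0 : \sum_(i | J i) ratfun_const d (alpha i) * K i = 0.
  apply: (@sums_to_zero R d); apply: sums_to_eq (sums_to_sum alpha KJ) => v.
  apply: (@min_pairing_relation R d _ J P alpha v
    (fun i => min_pairing (P i) 0 v) (powR y0)) => // [i|x].
    move=> /asboolP P0; have [x [_ [Px _ minx _]]] := pairing_range v (Pcompact i) P0.
    have mE : min_pairing (P i) 0 v = pairing v x.
      by rewrite (min_pairingE _ Px minx) pairing0r subr0.
    by exists x; rewrite mE; split.
  rewrite -[RHS](hsum x) [LHS]big_mkcond; apply: eq_bigr => i _.
  case: ifPn => // /asboolPn nP; rewrite indicE memNset ?mulr0// => Px.
  by apply: nP; exists x.
rewrite -[RHS]K0 big_mkcond [RHS]big_mkcond; apply: eq_bigr => i _.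
rewrite /K; case: ltnP => ia; last by rewrite mulr0 if_same.
by rewrite ifT//; apply/asboolP/full_nonempty/hfull.
Qed.
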